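(* Let $N\ge3$, $\gamma\in(0,1)$, and let $p_0,p_1,p_2,p_3\in[0,1]$ with $0<p_m<1$ for $m=0,1,2$ or $0<p_m<1$ for $m=1,2,3$ (so that the Markov chain with one-step transition matrix $P_{C'}^\circ:=\gamma P_{A'}^\circ+(1-\gamma)P_B^\circ$ is ergodic). Let $\{X_n^\circ\}_{n\ge0}$ be a time-homogeneous Markov chain in $\Sigma^\circ$ with one-step transition matrix $P_{C'}^\circ$ and arbitrary distribution of $X_0^\circ$, and let $\xi_n:=w^\circ(X_{n-1}^\circ,X_n^\circ)$ and $S_n:=\xi_1+\cdots+\xi_n$ for $n\ge1$. Then $$\lim_{n\to\infty}\frac{S_n}{n}=\mu^\circ_{(\gamma,1-\gamma)'}\quad\text{a.s.},$$ and, if $(\sigma^\circ_{(\gamma,1-\gamma)'})^2>0$, then $$\frac{S_n-n\mu^\circ_{(\gamma,1-\gamma)'}}{\sqrt{n(\sigma^\circ_{(\gamma,1-\gamma)'})^2}}\to_d N(0,1)\quad\text{as }n\to\infty.$$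
   Context: Players are labeled $1,\dots,N$ in a circle (labels mod $N$). For $\eta\in\{0,1\}^N$ let $m_x(\eta):=2\eta(x-1)+\eta(x+1)$, let $\eta_x$ be $\eta$ with the $x$th coordinate flipped, and let $q_m:=1-p_m$. For $y\in\{x-1,x+1\}$, $\eta^{x,y,1}$ (resp. $\eta^{x,y,-1}$) is $\eta$ with $\eta(x)$ set to $1$ and $\eta(y)$ set to $0$ (resp. $\eta(x)$ set to $0$ and $\eta(y)$ set to $1$). The state space is $\Sigma^\circ:=\{0,1\}^N\times\{-1,0,1\}$ (statuses of the players, and total profit from the last game). $P_B^\circ$: $P_B^\circ((\eta,s),(\eta_x,1))=N^{-1}p_{m_x(\eta)}$ if $\eta(x)=0$ and $0$ if $\eta(x)=1$; $P_B^\circ((\eta,s),(\eta_x,-1))=N^{-1}q_{m_x(\eta)}$ if $\eta(x)=1$ and $0$ if $\eta(x)=0$; $P_B^\circ((\eta,s),(\eta,1))=N^{-1}\sum_{x:\eta(x)=1}p_{m_x(\eta)}$; $P_B^\circ((\eta,s),(\eta,-1))=N^{-1}\sum_{x:\eta(x)=0}q_{m_x(\eta)}$; all other entries $0$. $P_{A'}^\circ$: $P_{A'}^\circ((\eta,s),(\zeta,0))=\frac1{4N}\#\{(x,y,\epsilon):1\le x\le N,\ y\in\{x-1,x+1\},\ \epsilon\in\{-1,1\},\ \eta^{x,y,\epsilon}=\zeta\}$; all other entries $0$. Payoff: $w^\circ((\eta,s),(\eta_x,t))=t$ if $\eta(x)=(1-t)/2$, and $w^\circ((\eta,s),(\eta,t))=t$,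 for $t\in\{-1,1\}$; $w^\circ=0$ otherwise. Let $W^\circ$ be the matrix of $w^\circ$; $\dot P_{C'}^\circ$ and $\ddot P_{C'}^\circ$ are the entrywise products $P_{C'}^\circ\circ W^\circ$ and $P_{C'}^\circ\circ W^\circ\circ W^\circ$. ''Ergodic'' means having a unique stationary distribution to which the chain converges from every initial distribution (transient/inaccessible states are allowed). Let the row vector $\pi_{C'}^\circ$ be the unique stationary distribution of $P_{C'}^\circ$, $\mathbf 1$ the column vector of ones indexed by $\Sigma^\circ$, $Z_{C'}^\circ:=(I-(P_{C'}^\circ-\mathbf 1\pi_{C'}^\circ))^{-1}$, and $$\mu^\circ_{(\gamma,1-\gamma)'}:=\pi_{C'}^\circ\dot P_{C'}^\circ\mathbf 1,\qquad(\sigma^\circ_{(\gamma,1-\gamma)'})^2:=\pi_{C'}^\circ\ddot P_{C'}^\circ\mathbf 1-(\pi_{C'}^\circ\dot P_{C'}^\circ\mathbf 1)^2+2\pi_{C'}^\circ\dot P_{C'}^\circ(Z_{C'}^\circ-\mathbf 1\pi_{C'}^\circ)\dot P_{C'}^\circ\mathbf 1.$$ *)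

(* Defs.v *)
From HB Require Import structures.
From mathcomp Require Import all_boot all_order all_algebra.
From mathcomp Require Import all_classical all_reals all_analysis.
Set Implicit Arguments.
Unset Strict Implicit.
Unset Printing Implicit Defensive.
Import Order.TTheory GRing.Theory Num.Theory.
Import numFieldNormedType.Exports.
Local Open Scope classical_set_scope.
Local Open Scope ring_scope.

(* Players are labelled by 'I_N = {0, ..., N-1} instead of {1, ..., N};
   [ord_pred x] and [ordS x] are the cyclic neighbours x - 1 and x + 1 mod N. *)
Definition config (N : nat) := {ffun 'I_N -> bool}.

Definition last_profit := seq_sub [:: -1; 0; 1 : int].

Definition state (N : nat) : finType := (config N * last_profit)%type.

Definition flip (N : nat) (eta : config N) (x : 'I_N) : config N :=
  [ffun z => if z == x then ~~ eta z else eta z].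

(* eta^{x,y,1} for eps = true and eta^{x,y,-1} for eps = false *)
Definition transfer (N : nat) (eta : config N) (x y : 'I_N) (eps : bool) :
    config N :=
  [ffun z => if z == x then eps else if z == y then ~~ eps else eta z].

(* The value 2 eta(x-1) + eta(x+1) is at most 3, so [inord] does not truncate. *)
Definition nbr_index (N : nat) (eta : config N) (x : 'I_N) : 'I_4 :=
  inord (2 * eta (ord_pred x) + eta (ordS x)).

(* Since the [flip eta x] are pairwise distinct and differ from [eta], the sums
   restricted to [zeta == flip eta x] have at most one term. *)
Definition PB_entry (R : realType) (N : nat) (p : 'I_4 -> R)
    (u v : state N) : R :=
  let: (eta, _) := u in
  let: (zeta, t) := v in
  if val t == 1 then
    if zeta == eta then
      N%:R^-1 * \sum_(x < N | eta x) p (nbr_index eta x)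
    else
      \sum_(x < N | (zeta == flip eta x) && ~~ eta x)
        N%:R^-1 * p (nbr_index eta x)
  else if val t == -1 then
    if zeta == eta then
      N%:R^-1 * \sum_(x < N | ~~ eta x) (1 - p (nbr_index eta x))
    else
      \sum_(x < N | (zeta == flip eta x) && eta x)
        N%:R^-1 * (1 - p (nbr_index eta x))
  else 0.

Definition PA_entry (R : realType) (N : nat) (u v : state N) : R :=
  let: (eta, _) := u in
  let: (zeta, t) := v in
  if val t == 0 then
    (4 * N)%:R^-1 *
    #|[set a : 'I_N * 'I_N * bool |
        let: (x, y, eps) := a in
        ((y == ord_pred x) || (y == ordS x)) &&
        (transfer eta x y eps == zeta)]%SET|%:R
  else 0.

(* For t in {-1, 1}, eta(x) = (1 - t)/2 says that eta(x) = 1 iff t = -1. *)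
Definition payoff (R : realType) (N : nat) (u v : state N) : R :=
  let: (eta, _) := u in
  let: (zeta, t) := v in
  if ((val t == 1) || (val t == -1)) &&
     ((zeta == eta) ||
      [exists x : 'I_N, (zeta == flip eta x) && (eta x == (val t == -1))])
  then (val t)%:~R else 0.

Definition mx_of (R : realType) (T : finType) (f : T -> T -> R) :
    'M[R]_#|T| :=
  \matrix_(i, j) f (enum_val i) (enum_val j).

Definition PB (R : realType) (N : nat) (p : 'I_4 -> R) : 'M[R]_#|state N| :=
  mx_of (@PB_entry R N p).

Definition PA (R : realType) (N : nat) : 'M[R]_#|state N| :=
  mx_of (@PA_entry R N).

Definition PC (R : realType) (N : nat) (gamma : R) (p : 'I_4 -> R) :
    'M[R]_#|state N| :=
  gamma *: PA R N + (1 - gamma) *: PB N p.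

Definition W (R : realType) (N : nat) : 'M[R]_#|state N| :=
  mx_of (@payoff R N).

Definition entrywise (R : realType) (m n : nat) (A B : 'M[R]_(m, n)) :
    'M[R]_(m, n) :=
  \matrix_(i, j) (A i j * B i j).

Definition distr (R : realType) (n : nat) (nu : 'rV[R]_n) : Prop :=
  (forall i, 0 <= nu 0 i) /\ \sum_i nu 0 i = 1.

Definition stationary (R : realType) (n : nat) (P : 'M[R]_n)
    (nu : 'rV[R]_n) : Prop :=
  distr nu /\ nu *m P = nu.

Definition ergodic (R : realType) (n : nat) (P : 'M[R]_n) : Prop :=
  exists nu : 'rV[R]_n,
    [/\ stationary P nu,
        forall nu', stationary P nu' -> nu' = nu &
        forall nu0, distr nu0 -> forall j,
          (nu0 *m P ^+ k) 0 j @[k --> \oo] --> nu 0 j].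

(* A stationary distribution chosen by classical choice: it is the stationary
   distribution as soon as that is unique, in particular when P is ergodic. *)
Definition stationary_distr (R : realType) (n : nat) (P : 'M[R]_n) :
    'rV[R]_n :=
  xget 0 [set nu | stationary P nu].

Definition ones (R : realType) (n : nat) : 'cV[R]_n := const_mx 1.

(* The fundamental matrix Z; the matrix inverted here is invertible whenever
   P is a stochastic ergodic matrix. *)
Definition fundamental_mx (R : realType) (n : nat) (P : 'M[R]_n) : 'M[R]_n :=
  invmx (1%:M - (P - ones R n *m stationary_distr P)).

Definition mean_profit (R : realType) (N : nat) (gamma : R) (p : 'I_4 -> R) :
    R :=
  let P := PC N gamma p in
  (stationary_distr P *m entrywise P (W R N) *m ones R #|state N|) 0 0.

Definition var_profit (R : realType) (N : nat) (gamma : R) (p : 'I_4 -> R) :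
    R :=
  let P := PC N gamma p in
  let pi := stationary_distr P in
  let dP := entrywise P (W R N) in
  let ddP := entrywise dP (W R N) in
  let one := ones R #|state N| in
  (pi *m ddP *m one) 0 0 - (pi *m dP *m one) 0 0 ^+ 2
  + 2 * (pi *m dP *m (fundamental_mx P - one *m pi) *m dP *m one) 0 0.

Definition cond_prob (R : realType) (d : measure_display)
    (Omega : measurableType d) (Pr : probability Omega R)
    (A B : set Omega) : R :=
  fine (Pr (A `&` B)) / fine (Pr B).

(* No condition is put on the law of [X 0]. *)
Definition markov_chain (R : realType) (d : measure_display)
    (Omega : measurableType d) (Pr : probability Omega R) (T : finType)
    (X : nat -> Omega -> T) (P : 'M[R]_#|T|) : Prop :=
  (forall n (u : T), measurable (X n @^-1` [set u])) /\
  (forall n (u : nat -> T) (v : T),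
    let past := [set w | forall k, (k <= n)%N -> X k w = u k] in
    (0 < Pr past)%E ->
    cond_prob Pr (X n.+1 @^-1` [set v]) past
      = P (enum_rank (u n)) (enum_rank v)).

Definition profit (R : realType) (N : nat) (Omega : Type)
    (X : nat -> Omega -> state N) (n : nat) (w : Omega) : R :=
  payoff R (X n.-1 w) (X n w).

Definition total_profit (R : realType) (N : nat) (Omega : Type)
    (X : nat -> Omega -> state N) (n : nat) (w : Omega) : R :=
  \sum_(1 <= k < n.+1) profit R X k w.

(* Convergence in distribution of real random variables to a law [nu]:
   convergence of the cumulative distribution functions at every continuity
   point of that of [nu]. *)
Definition cvg_in_distribution (R : realType) (d : measure_display)
    (Omega : measurableType d) (Pr : probability Omega R)
    (Y : nat -> Omega -> R) (nu : probability (measurableTypeR R) R) : Prop :=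
  (forall n, measurable_fun [set: Omega] (Y n)) /\
  (forall x : R,
    {for x, continuous (fun r : R => nu `]-oo, r]%classic)} ->
    Pr (Y n @^-1` `]-oo, x]%classic) @[n --> \oo]
      --> nu `]-oo, x]%classic).

(* Main.v *)
(* Write the profit of a step as mu + d(u, v) + g(u) - g(v), where g solves the
   Poisson equation (1 - P) g = r - mu for the mean one-step profit r; then S_n -
   n mu is, up to a bounded term, the additive functional M_n of the increments
   d, whose conditional means vanish. Expectations of functions of (M_n, X_n)
   are iterates of the operator K F(m, u) = sum_v p(u, v) F(m + d(u, v), v), so
   both limit theorems reduce to estimates on K.
   - Law of large numbers: K contracts exponentials up to a factor
     exp(2 l^2 D^2), which gives the Chernoff-Azuma bound, then Borel-Cantelli.
   - Central limit theorem: G_s(m) = Phi((c - m) / s) solves the heat equation in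
     (s^2, m), and adding h G_s'' / 2, where h solves the Poisson equation for
     the conditional variance of d, makes one application of K agree with the
     replacement of s^2 by s^2 + sigma^2 up to O(s^-3). Starting at
     s = delta sqrt(n sigma^2) the accumulated error is O(n^-1/2), and G_s is
     close to the indicator of m <= c once delta is small.
   Ergodicity is Doeblin's theorem: the all-losers state (if q_0, q_1, q_2 > 0)
   or the all-winners state (if p_1, p_2, p_3 > 0) has a loop and is reached from
   everywhere, by flipping players next to one who already has the wanted
   status; game A' is only needed to leave the opposite constant state. *)
Require Import Defs.
From HB Require Import structures.
From mathcomp Require Import all_boot all_order all_algebra.
From mathcomp Require Import all_classical all_reals all_analysis.
From mathcomp Require Import zify ring lra.
Set Implicit Arguments.
Unset Strict Implicit.
Unset Printing Implicit Defensive.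
Import Order.TTheory GRing.Theory Num.Theory.
Import numFieldNormedType.Exports.
Local Open Scope classical_set_scope.
Local Open Scope ring_scope.

(** * Stochastic matrices *)

Definition stochastic (R : realType) (n : nat) (P : 'M[R]_n) : Prop :=
  (forall i j, 0 <= P i j) /\ (forall i, \sum_j P i j = 1).

Definition l1norm (R : realType) (n : nat) (x : 'rV[R]_n) : R :=
  \sum_j `|x 0 j|.

Lemma l1norm_ge0 (R : realType) (n : nat) (x : 'rV[R]_n) : 0 <= l1norm x.
Proof. exact: sumr_ge0. Qed.

Lemma l1norm_mulmx (R : realType) (n : nat) (Q : 'M[R]_n) (c : R)
    (x : 'rV[R]_n) :
  (forall i j, 0 <= Q i j) -> (forall i, \sum_j Q i j = c) ->
  l1norm (x *m Q) <= c * l1norm x.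
Proof.
move=> Q0 Qc; rewrite /l1norm.
have -> : c * (\sum_i `|x 0 i|) = \sum_j \sum_i `|x 0 i| * Q i j.
  rewrite exchange_big mulr_sumr; apply: eq_bigr => i _ /=.
  by rewrite -mulr_sumr Qc mulrC.
apply: ler_sum => j _; rewrite mxE; apply: le_trans (ler_norm_sum _ _ _) _.
by apply: ler_sum => i _; rewrite normrM (ger0_norm (Q0 _ _)).
Qed.

Lemma stochastic_mul (R : realType) (n : nat) (P Q : 'M[R]_n) :
  stochastic P -> stochastic Q -> stochastic (P * Q).
Proof.
move=> [P0 P1] [Q0 Q1]; split=> [i j|i].
  by rewrite mxE; apply: sumr_ge0 => k _; exact: mulr_ge0.
under eq_bigr do rewrite mxE.
rewrite exchange_big -[RHS](P1 i); apply: eq_bigr => k _ /=.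
by rewrite -mulr_sumr Q1 mulr1.
Qed.

Lemma stochastic_exp (R : realType) (n : nat) (P : 'M[R]_n) (k : nat) :
  stochastic P -> stochastic (P ^+ k).
Proof.
move=> sP; elim: k => [|k IH]; last by rewrite exprS; exact: stochastic_mul.
rewrite expr0; split=> [i j|i]; first by rewrite mxE; case: (i == j).
rewrite (bigD1 i) //= big1 ?mxE ?eqxx ?addr0 //.
by move=> j ji; rewrite mxE eq_sym (negPf ji).
Qed.

Lemma stochastic_ones (R : realType) (n : nat) (P : 'M[R]_n) :
  stochastic P -> P *m ones R n = ones R n.
Proof.
move=> [_ P1]; apply/matrixP => i j; rewrite !mxE -[RHS](P1 i).
by apply: eq_bigr => k _; rewrite mxE mulr1.
Qed.

(* Subtracting the mass d in column o does not change x *m Q when the entries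
   of x sum to 0, and leaves a matrix with row sums 1 - d. *)
Lemma l1norm_doeblin (R : realType) (n : nat) (Q : 'M[R]_n) (d : R)
    (o : 'I_n) (x : 'rV[R]_n) :
  stochastic Q -> (forall i, d <= Q i o) -> \sum_j x 0 j = 0 ->
  l1norm (x *m Q) <= (1 - d) * l1norm x.
Proof.
move=> [Q0 Q1] dQ x0; pose Q' : 'M[R]_n := \matrix_(i, j) (Q i j - d *+ (j == o)).
have -> : x *m Q = x *m Q'.
  apply/rowP => j; rewrite !mxE.
  under [RHS]eq_bigr do rewrite mxE mulrBr.
  by rewrite sumrB -mulr_suml x0 mul0r subr0.
apply: l1norm_mulmx => [i j|i]; rewrite ?mxE.
  by have [->|_] := eqVneq j o; rewrite ?subr0 // subr_ge0.
under eq_bigr do rewrite mxE.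
rewrite sumrB Q1 (bigD1 o) //= eqxx big1 ?addr0 // => j /negPf ->.
by rewrite mulr0n.
Qed.

(* A left null vector x of 1 - P gives |x| <= |x| P entrywise, and both sides
   have the same total mass. *)
Lemma stationary_exists (R : realType) (n : nat) (P : 'M[R]_n) (o : 'I_n) :
  stochastic P -> exists nu, stationary P nu.
Proof.
move=> sP; have [P0 P1] := sP.
(* [det0P] yields left null vectors, so the right null vector [ones] of [1 - P] enters through the
   transpose; the index [o] shows that it is nonzero. *)
have : \det (1%:M - P) == 0.
  rewrite -det_tr; apply/det0P; exists (ones R n)^T.
    by apply/eqP => /rowP /(_ o); rewrite !mxE; exact/eqP/oner_neq0.
  by rewrite -trmx_mul mulmxBl mul1mx stochastic_ones // subrr trmx0.
move=> /det0P [x xN0]; rewrite mulmxBr mulmx1 => /eqP; rewrite subr_eq0 => /eqP xP.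
pose y : 'rV[R]_n := \row_j `|x 0 j|.
have yle j : y 0 j <= (y *m P) 0 j.
  rewrite !mxE {1}xP mxE; apply: le_trans (ler_norm_sum _ _ _) _.
  by apply: ler_sum => i _; rewrite mxE normrM (ger0_norm (P0 _ _)).
have yPs : \sum_j (y *m P) 0 j = \sum_j y 0 j.
  under eq_bigr do rewrite mxE.
  rewrite exchange_big; apply: eq_bigr => i _ /=.
  by rewrite -mulr_sumr P1 mulr1.
have yP : y *m P = y.
  apply/rowP => j; apply/eqP; rewrite -subr_eq0; apply/eqP.
  have /psumr_eq0P -> // : \sum_k ((y *m P) 0 k - y 0 k) = 0.
    by rewrite sumrB yPs subrr.
  by move=> k _; rewrite subr_ge0.
have s0 : 0 < \sum_j y 0 j.
  rewrite lt_neqAle sumr_ge0 ?andbT; last by move=> i _; rewrite mxE.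
  apply: contra xN0 => /eqP/esym/psumr_eq0P H; apply/eqP/rowP => j; rewrite mxE.
  by apply/eqP; rewrite -normr_eq0; move: (H (fun k _ => ltac:(rewrite mxE //)) j isT); rewrite mxE => ->.
exists ((\sum_j y 0 j)^-1 *: y); split; [split|].
- by move=> i; rewrite !mxE mulr_ge0 // invr_ge0 ltW.
- by under eq_bigr do rewrite mxE; rewrite -mulr_sumr mulVf // gt_eqF.
- by rewrite -scalemxAl yP.
Qed.

(** Each full block of [m] steps contracts by [1 - d], and the remaining [k %% m] steps do not
    increase the norm. *)
Lemma l1norm_doeblin_exp (R : realType) (n : nat) (P : 'M[R]_n) (m : nat)
    (d : R) (o : 'I_n) (x : 'rV[R]_n) (k : nat) :
  stochastic P -> (forall i, d <= (P ^+ m) i o) -> \sum_j x 0 j = 0 ->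
  0 <= 1 - d -> l1norm (x *m P ^+ k) <= (1 - d) ^+ (k %/ m) * l1norm x.
Proof.
move=> sP dP x0 d1; rewrite {1}(divn_eq k m) exprD -mulmxE mulmxA.
have sumP (Q : 'M[R]_n) : stochastic Q -> \sum_j (x *m Q) 0 j = 0.
  move=> [_ Q1]; under eq_bigr do rewrite mxE.
  by rewrite exchange_big -[RHS]x0; apply: eq_bigr => i _ /=; rewrite -mulr_sumr Q1 mulr1.
have sk := stochastic_exp (k %% m) sP.
apply: le_trans (l1norm_mulmx _ sk.1 sk.2) _; rewrite mul1r.
elim: (k %/ m)%N => [|q IH]; first by rewrite mul0n !expr0 mulmx1 mul1r.
rewrite mulSnr exprD -mulmxE mulmxA.
apply: (le_trans (l1norm_doeblin (stochastic_exp m sP) dP _)).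
  exact/sumP/stochastic_exp.
by rewrite exprS -mulrA ler_wpM2l.
Qed.

(** The difference of two distributions has entries summing to 0, so its iterates decay
    geometrically. Comparison with one stationary [nu] gives convergence; a second stationary
    distribution is its own iterate, hence equal to the limit. *)
Lemma doeblin_ergodic (R : realType) (n : nat) (P : 'M[R]_n) (m : nat)
    (d : R) (o : 'I_n) :
  stochastic P -> 0 < d -> (0 < m)%N -> (forall i, d <= (P ^+ m) i o) ->
  ergodic P.
Proof.
move=> sP d0 m0 dP; have [nu snu] := stationary_exists o sP.
have [[nu0 nu1] nuP] := snu.
have nuPk k : nu *m P ^+ k = nu.
  elim: k => [|k IH]; first by rewrite expr0 mulmx1.
  by rewrite exprS -mulmxE mulmxA nuP.
have d1 : 0 <= 1 - d.
  have [Q0 Q1] := stochastic_exp m sP.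
  rewrite subr_ge0; apply: (le_trans (dP o)); rewrite -(Q1 o).
  by rewrite (bigD1 o) //= lerDl sumr_ge0.
have cvg mu : distr mu -> forall j, (mu *m P ^+ k) 0 j @[k --> \oo] --> nu 0 j.
  move=> [mu0 mu1] j; have x0 : \sum_j (mu - nu) 0 j = 0.
    by under eq_bigr do rewrite !mxE; rewrite sumrB mu1 nu1 subrr.
  apply/cvgrPdist_le => e e0.
  have : (1 - d) ^+ k * l1norm (mu - nu) @[k --> \oo] --> (0 : R).
    rewrite -(mul0r (l1norm (mu - nu))); apply: cvgMl; apply: cvg_expr.
    by rewrite ger0_norm // ltrBlDr ltrDl.
  move=> /cvgrPdist_le /(_ _ e0) [K _ HK]; exists (K * m)%N => //= k Kk.
  have /= := HK (k %/ m)%N; rewrite leq_divRL // sub0r normrN => /(_ Kk) le_e.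
  move: le_e; rewrite ger0_norm ?mulr_ge0 ?exprn_ge0 ?l1norm_ge0 //.
  apply: le_trans; apply: le_trans (l1norm_doeblin_exp k sP dP x0 d1).
  rewrite mulmxBl nuPk distrC /l1norm (bigD1 j) //= !mxE lerDl.
  exact: sumr_ge0.
exists nu; split=> // nu' [dnu' nu'P]; apply/rowP => j.
have nu'Pk k : nu' *m P ^+ k = nu'.
  elim: k => [|k IH]; first by rewrite expr0 mulmx1.
  by rewrite exprS -mulmxE mulmxA nu'P.
have := cvg nu' dnu' j; under eq_fun do rewrite nu'Pk.
move=> H; apply: (@cvg_unique _ _ _ _ _ _ _ H) => //; exact: cvg_cst.
Qed.

Lemma exp_mx_gt0_trans (R : realType) (n : nat) (P : 'M[R]_n) (a b : nat)
    (i j k : 'I_n) :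
  stochastic P -> 0 < (P ^+ a) i j -> 0 < (P ^+ b) j k -> 0 < (P ^+ (a + b)) i k.
Proof.
move=> sP ij jk; have [A0 _] := stochastic_exp a sP.
have [B0 _] := stochastic_exp b sP.
rewrite exprD mxE (bigD1 j) //= ltr_pwDl ?mulr_gt0 //.
by apply: sumr_ge0 => l _; exact: mulr_ge0.
Qed.

(** The loop at [o] lets every path wait there, so all states reach [o] in one common number of
    steps; finiteness then gives a positive lower bound valid for all of them. *)
Lemma reachable_ergodic (R : realType) (n : nat) (P : 'M[R]_n) (o : 'I_n) :
  stochastic P -> 0 < P o o -> (forall i, exists k, 0 < (P ^+ k) i o) ->
  ergodic P.
Proof.
move=> sP Poo /choice [k kP].
have loop m : 0 < (P ^+ m) o o.
  elim: m => [|m IH]; first by rewrite expr0 mxE eqxx ltr01.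
  by rewrite -addn1; apply: exp_mx_gt0_trans IH _; rewrite // expr1.
(* The successor keeps [m] positive even if every [k i] is 0. *)
pose m := (\max_i k i).+1.
have mP i : 0 < (P ^+ m) i o.
  have ki : (k i <= m)%N by apply: leqW; exact: leq_bigmax.
  by rewrite -(subnKC ki); exact: exp_mx_gt0_trans (kP i) (loop _).
pose d := \big[Num.min/1]_i (P ^+ m) i o.
apply: (@doeblin_ergodic _ _ _ m d o) => //.
  by rewrite /d; apply: lt_bigmin.
by move=> i; exact: bigmin_le.
Qed.

(** * Stationary distribution, fundamental matrix and Poisson equation *)

Lemma stationary_distrP (R : realType) (n : nat) (P : 'M[R]_n) :
  ergodic P -> stationary P (stationary_distr P).
Proof. by move=> [nu [snu _ _]]; apply: (xgetPex 0); exists nu. Qed.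

Lemma mul_distr_ones (R : realType) (n : nat) (nu : 'rV[R]_n) :
  distr nu -> nu *m ones R n = 1%:M.
Proof.
move=> [_ nu1]; apply/matrixP => i j; rewrite !ord1 !mxE eqxx -[RHS]nu1.
by apply: eq_bigr => k _; rewrite mxE mulr1.
Qed.

(** Multiplying by [pi] shows that a right null vector [x] has [pi *m x = 0], so [x] is fixed by [P]
    and by all its powers. The rows of [P ^+ k] tend to [pi], so every entry of [x] equals
    [pi *m x], which is 0. *)
Lemma fundamental_mx_unit (R : realType) (n : nat) (P : 'M[R]_n) :
  stochastic P -> ergodic P ->
  1%:M - (P - ones R n *m stationary_distr P) \in unitmx.
Proof.
move=> sP eP; have [dpi piP] := stationary_distrP eP.
set pi := stationary_distr P in dpi piP *.
have [nu [snu nuU cvg]] := eP.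
have {nuU}pinu : pi = nu by exact/nuU/(stationary_distrP eP).
rewrite -unitmx_tr -row_free_unit -kermx_eq0; apply/rowV0P => y /sub_kermxP.
move=> /(congr1 trmx); rewrite trmx_mul trmxK trmx0; set x := y^T => Ax.
have pix : pi *m x = 0.
  have := congr1 (mulmx pi) Ax; rewrite mulmx0 mulmxA mulmxBr mulmxBr mulmx1 piP.
  by rewrite mulmxA mul_distr_ones // mul1mx subrr subr0.
have xP : P *m x = x.
  move: Ax; rewrite !mulmxBl mul1mx -mulmxA pix mulmx0 subr0 => /eqP.
  by rewrite subr_eq0 => /eqP/esym.
have xPk k : P ^+ k *m x = x.
  elim: k => [|k IH]; first by rewrite expr0 mul1mx.
  by rewrite exprSr -mulmxE -mulmxA xP.
apply/trmx_inj; rewrite -/x trmx0; apply/colP => i; rewrite [RHS]mxE.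
have de : distr (delta_mx 0 i : 'rV[R]_n).
  split=> [j|]; first by rewrite mxE; case: (_ && _).
  rewrite (bigD1 i) //= mxE !eqxx big1 ?addr0 // => j /negPf ji.
  by rewrite mxE ji andbF.
have c2 : \sum_j (delta_mx 0 i *m P ^+ k : 'rV[R]_n) 0 j * x j 0 @[k --> \oo] -->
    \sum_j nu 0 j * x j 0.
  apply: cvg_big => [|j _]; first exact: add_continuous.
  by apply: cvgMl; exact: cvg.
have E k : \sum_j (delta_mx 0 i *m P ^+ k : 'rV[R]_n) 0 j * x j 0 = x i 0.
  transitivity (((delta_mx 0 i : 'rV[R]_n) *m x) 0 0); last by rewrite -rowE mxE.
  by rewrite -{2}(xPk k) mulmxA [RHS]mxE.
move: c2; under eq_fun do rewrite E.
have -> : \sum_j nu 0 j * x j 0 = 0.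
  by move: pix => /matrixP /(_ 0 0); rewrite pinu !mxE.
move=> H; apply: (@cvg_unique _ _ _ _ _ _ _ H) => //; exact: cvg_cst.
Qed.

(** The row [pi] is a left fixed vector of the matrix being inverted. *)
Lemma stationary_fundamental_mx (R : realType) (n : nat) (P : 'M[R]_n) :
  stochastic P -> ergodic P ->
  stationary_distr P *m fundamental_mx P = stationary_distr P.
Proof.
move=> sP eP; have [dpi piP] := stationary_distrP eP.
have U := fundamental_mx_unit sP eP.
set pi := stationary_distr P in dpi piP U *.
have H : pi *m (1%:M - (P - ones R n *m pi)) = pi.
  by rewrite mulmxBr mulmxBr mulmx1 piP mulmxA mul_distr_ones // mul1mx subrr subr0.
by rewrite -{1}H mulmxK.
Qed.

(** Expanding [A *m Z = 1] with [pi *m Z = pi] gives [Z - P *m Z = 1 - ones *m pi]. The term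
    [ones *m pi] subtracted in [h] cancels, since [P] fixes [ones]; it normalises [h] to have mean 0
    under [pi]. *)
Lemma poisson_equation (R : realType) (n : nat) (P : 'M[R]_n) (f : 'cV[R]_n) :
  stochastic P -> ergodic P ->
  let pi := stationary_distr P in
  let h := (fundamental_mx P - ones R n *m pi) *m f in
  h - P *m h = f - ones R n *m (pi *m f).
Proof.
move=> sP eP pi h; have [dpi piP] := stationary_distrP eP; rewrite -/pi in dpi piP.
have U := fundamental_mx_unit sP eP; rewrite -/pi in U.
set Z := fundamental_mx P in h *.
have AZ : (1%:M - (P - ones R n *m pi)) *m Z = 1%:M by exact: mulmxV.
have piZ : pi *m Z = pi := stationary_fundamental_mx sP eP.
move: AZ; rewrite !mulmxBl mul1mx -mulmxA piZ => AZ.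
have -> : P *m h = (P *m Z - ones R n *m pi) *m f.
  by rewrite /h mulmxA mulmxBr (mulmxA P) stochastic_ones.
rewrite /h -mulmxBl.
have -> : Z - ones R n *m pi - (P *m Z - ones R n *m pi) = 1%:M - ones R n *m pi.
  by rewrite -AZ addrAC.
by rewrite mulmxBl mul1mx mulmxA.
Qed.

(** * The Gaussian distribution function *)

Lemma derive_bound (R : realType) (f df : R -> R) (M r : R) :
  (forall x : R, is_derive x 1 f (df x)) ->
  (forall x, `|x| <= `|r| -> `|df x| <= M) ->
  `|f r - f 0| <= M * `|r|.
Proof.
move=> fdf dfM.
have fc : continuous f by move=> x; apply/differentiable_continuous/derivable1_diffP.
have [r0|r0] := leP 0 r.
  have [x xr ->] := MVT_segment r0 (fun x _ => fdf x) (continuous_subspaceT fc).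
  rewrite subr0 normrM ler_wpM2r // dfM //; move: xr; rewrite in_itv /= => /andP[x0 xr].
  by rewrite !ger0_norm.
have [x xr] := MVT_segment (ltW r0) (fun x _ => fdf x) (continuous_subspaceT fc).
rewrite distrC => ->; rewrite sub0r normrM normrN ler_wpM2r // dfM //.
move: xr; rewrite in_itv /= => /andP[rx x0].
by rewrite !ler0_norm ?lerN2 // ltW.
Qed.

(** One application of the mean value bound raises the order of vanishing at 0 by one, at the price
    of the factor 1/(k+1). Repeated use gives the Taylor remainders below. *)
Lemma derive_bound_exp (R : realType) (f df : R -> R) (M r : R) (k : nat) :
  0 <= M -> f 0 = 0 -> (forall x : R, is_derive x 1 f (df x)) ->
  (forall x, `|x| <= `|r| -> `|df x| <= M * `|x| ^+ k) ->
  `|f r| <= M * `|r| ^+ k.+1.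
Proof.
move=> M0 f0 fdf dfM; rewrite -[f r]subr0 -f0 exprSr mulrA.
apply: derive_bound => // x xr; apply: le_trans (dfM _ xr) _.
by rewrite ler_wpM2l // lerXn2r ?nnegrE.
Qed.

Definition gauss_cdf (R : realType) (x : R) : R :=
  fine (normal_prob (0 : R) 1 `]-oo, x]).

Definition gauss_pdf (R : realType) (x : R) : R :=
  normal_peak (1 : R) * expR (- (x ^+ 2 / 2)).

Definition gauss_pdf1 (R : realType) (x : R) : R := - (x * gauss_pdf x).

Definition gauss_pdf2 (R : realType) (x : R) : R := (x ^+ 2 - 1) * gauss_pdf x.

Lemma normal_pdf_gauss (R : realType) : normal_pdf (0 : R) 1 = @gauss_pdf R.
Proof.
rewrite normal_pdfE ?oner_neq0 //; apply/funext => x.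
by rewrite /gauss_pdf /normal_fun subr0 expr1n mulNr.
Qed.

(** The fundamental theorem of calculus is applied on the half-line up to [x + 1], so that [x] is an
    interior point. *)
Lemma is_derive_gauss_cdf (R : realType) (x : R) :
  is_derive x 1 (@gauss_cdf R) (gauss_pdf x).
Proof.
have xx1 : x < x + 1 by rewrite ltrDl.
have ig : (@lebesgue_measure R).-integrable [set` Interval -oo%O (BRight (x + 1))]
    (EFin \o normal_pdf (0 : R) 1).
  exact: integrableS (integrable_normal_pdf 0 1).
have cg : {for x, continuous (normal_pdf (0 : R) 1)}.
  by apply: continuous_normal_pdf; exact: oner_neq0.
have [d1 d2] := continuous_FTC1 xx1 ig (ltNyr x) cg.
have E : @gauss_cdf R = fun y => (\int[lebesgue_measure]_(t in [set` `]-oo, y]])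
   (normal_pdf 0 1 t))%R by [].
apply: DeriveDef; rewrite E // -derive1E d2.
by rewrite normal_pdf_gauss.
Qed.

Lemma is_derive_gauss_pdf (R : realType) (x : R) :
  is_derive x 1 (@gauss_pdf R) (gauss_pdf1 x).
Proof.
have d2 : is_derive x 1 (normal_peak 1 \*: (@expR R \o (fun y : R => - (y ^+ 2 / 2))))
    (gauss_pdf1 x) by apply: is_derive_eq; rewrite /GRing.scale /= /gauss_pdf1 /gauss_pdf; field.
exact: d2.
Qed.

Lemma is_derive_gauss_pdf1 (R : realType) (x : R) :
  is_derive x 1 (@gauss_pdf1 R) (gauss_pdf2 x).
Proof.
have d := is_derive_gauss_pdf x.
have d2 : is_derive x 1 (- (@id R * @gauss_pdf R)) (gauss_pdf2 x).
  apply: is_derive_eq; rewrite /GRing.scale /= /gauss_pdf2 /gauss_pdf1; ring.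
exact: d2.
Qed.

(** One constant for the density, its first two derivatives and its products with powers of [x] up
    to the fourth. With y = x^2/2 one has 1 + x^2 + x^4 = 1 + 2y + 4y^2, and 1, 2y and 4y^2 are at
    most 1, 2 and 8 times exp y; hence 11. *)
Definition gauss_bound (R : realType) : R := 11 * normal_peak 1.

Lemma gauss_bound_ge0 (R : realType) : 0 <= gauss_bound R.
Proof. by rewrite mulr_ge0 // normal_peak_ge0. Qed.

Lemma gauss_pdf_ge0 (R : realType) (x : R) : 0 <= gauss_pdf x.
Proof. by rewrite mulr_ge0 ?normal_peak_ge0 ?expR_ge0. Qed.

Lemma gauss_pdf_poly_bound (R : realType) (x : R) :
  (1 + x ^+ 2 + x ^+ 4) * gauss_pdf x <= gauss_bound R.
Proof.
rewrite /gauss_pdf /gauss_bound mulrCA mulrC ler_wpM2r ?normal_peak_ge0 //.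
rewrite expRN ler_pdivrMr ?expR_gt0 //.
have y0 : 0 <= x ^+ 2 / 2 by rewrite divr_ge0 ?sqr_ge0.
have := expR_ge1Dxn 0 y0; have := expR_ge1Dxn 1 y0.
rewrite expr1 !factS fact0 !muln1 divr1.
have -> : x ^+ 4 = 4 * (x ^+ 2 / 2) ^+ 2 by field.
have -> : x ^+ 2 = 2 * (x ^+ 2 / 2) by field.
have -> : 2 * (x ^+ 2 / 2) / 2 = x ^+ 2 / 2 by field.
move: y0; move: (x ^+ 2 / 2) => y y0; move: (expR y) => e H1 H2.
lra.
Qed.

Lemma gauss_pdf_norm_bound (R : realType) (x : R) (k : nat) :
  (k <= 4)%N -> `|x| ^+ k * gauss_pdf x <= gauss_bound R.
Proof.
move=> k4; apply: le_trans (gauss_pdf_poly_bound x).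
apply: ler_wpM2r; first exact: gauss_pdf_ge0.
have -> : x ^+ 2 = `|x| ^+ 2 by rewrite real_normK ?num_real.
have -> : x ^+ 4 = `|x| ^+ 4.
  by rewrite -[4%N]/(2 * 2)%N !exprM real_normK ?num_real.
have := normr_ge0 x; set y := `|x| => y0.
case: k k4 => [|[|[|[|[|//]]]]] _; nra.
Qed.

Lemma gauss_pdf_bound (R : realType) (x : R) : `|gauss_pdf x| <= gauss_bound R.
Proof.
rewrite ger0_norm ?gauss_pdf_ge0 //.
by have := gauss_pdf_norm_bound x (leq0n 4); rewrite mul1r.
Qed.

Lemma gauss_pdf1_bound (R : realType) (x : R) : `|gauss_pdf1 x| <= gauss_bound R.
Proof.
rewrite normrN normrM (ger0_norm (gauss_pdf_ge0 x)).
exact: (@gauss_pdf_norm_bound _ x 1).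
Qed.

Lemma gauss_pdf2_bound (R : realType) (x : R) : `|gauss_pdf2 x| <= gauss_bound R.
Proof.
rewrite normrM (ger0_norm (gauss_pdf_ge0 x)); apply: le_trans (gauss_pdf_poly_bound x).
apply: ler_wpM2r; first exact: gauss_pdf_ge0.
have := sqr_ge0 x; have := sqr_ge0 (x ^+ 2); rewrite -exprM => H1 H2.
by rewrite ler_norml; apply/andP; split; lra.
Qed.

Lemma is_derive_comp_affine (R : realType) (f df : R -> R) (a b x : R) :
  (forall y : R, is_derive y 1 f (df y)) ->
  is_derive x 1 (fun e => f (a + b * e)) (b * df (a + b * x)).
Proof.
move=> fdf.
have d : is_derive x 1 (cst a + b \*: @id R) b.
  by apply: is_derive_eq; rewrite /GRing.scale /= add0r mulr1.
have -> : (fun e => f (a + b * e)) = f \o (cst a + b \*: @id R) by [].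
have df' := fdf ((cst a + b \*: @id R) x).
by apply: is_derive_eq; rewrite /GRing.scale /= mulrC.
Qed.

Lemma gauss_pdf1_lipschitz (R : realType) (z e : R) :
  `|gauss_pdf1 (z + e) - gauss_pdf1 z| <= gauss_bound R * `|e|.
Proof.
have := @derive_bound _ (fun e => gauss_pdf1 (z + 1 * e)) _ (gauss_bound R) e
  (fun y => is_derive_comp_affine z 1 y (@is_derive_gauss_pdf1 R)).
rewrite mul1r mulr0 addr0; apply => x _.
by rewrite mul1r gauss_pdf2_bound.
Qed.

Lemma gauss_cdf_lipschitz (R : realType) (z e : R) :
  `|gauss_cdf (z + e) - gauss_cdf z| <= gauss_bound R * `|e|.
Proof.
have := @derive_bound _ (fun e => gauss_cdf (z + 1 * e)) _ (gauss_bound R) e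
  (fun y => is_derive_comp_affine z 1 y (@is_derive_gauss_cdf R)).
rewrite mul1r mulr0 addr0; apply => x _.
by rewrite mul1r gauss_pdf_bound.
Qed.

(** The remainder [f0] has derivative [f1], the first-order remainder of the density, whose own
    derivative is controlled by the Lipschitz bound on [gauss_pdf1]; two integrations give the cubic
    order. *)
Lemma gauss_cdf_taylor (R : realType) (z e : R) :
  `|gauss_cdf (z + e) - gauss_cdf z - e * gauss_pdf z
     - e ^+ 2 / 2 * gauss_pdf1 z| <= gauss_bound R * `|e| ^+ 3.
Proof.
pose f0 e := gauss_cdf (z + 1 * e) - gauss_cdf z - e * gauss_pdf z
  - e ^+ 2 / 2 * gauss_pdf1 z.
pose f1 e := gauss_pdf (z + 1 * e) - gauss_pdf z - e * gauss_pdf1 z.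
have -> : gauss_cdf (z + e) - gauss_cdf z - e * gauss_pdf z
     - e ^+ 2 / 2 * gauss_pdf1 z = f0 e by rewrite /f0 mul1r.
apply: (@derive_bound_exp _ f0 f1 _ e 2).
- exact: gauss_bound_ge0.
- by rewrite /f0 mulr0 addr0 expr0n /= !mul0r subrr !subr0.
- move=> x; have d := is_derive_comp_affine z 1 x (@is_derive_gauss_cdf R).
  have -> : f0 = (fun e => gauss_cdf (z + 1 * e)) - cst (gauss_cdf z)
      - gauss_pdf z \*: @id R - (gauss_pdf1 z / 2) \*: (@id R ^+ 2).
    apply/funext => y; rewrite /f0 !fctE /GRing.scale /=; congr (_ - _ - _ - _).
      by rewrite mulrC.
    by rewrite mulrC mulrA mulrAC.
  by apply: is_derive_eq; rewrite /GRing.scale /= /f1; field.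
- move=> y _; apply: (@derive_bound_exp _ f1
      (fun e => 1 * gauss_pdf1 (z + 1 * e) - gauss_pdf1 z) _ y 1).
  + exact: gauss_bound_ge0.
  + by rewrite /f1 mulr0 addr0 mul0r !subrr.
  + move=> x; have d := is_derive_comp_affine z 1 x (@is_derive_gauss_pdf R).
    have -> : f1 = (fun e => gauss_pdf (z + 1 * e)) - cst (gauss_pdf z)
        - gauss_pdf1 z \*: @id R.
      by apply/funext => u; rewrite /f1 !fctE /GRing.scale /=; congr (_ - _ - _); rewrite mulrC.
    apply: is_derive_eq; rewrite /GRing.scale /=; ring.
  + by move=> x _; rewrite !mul1r expr1 gauss_pdf1_lipschitz.
Qed.

(** Expansion in the scaling factor, uniform in [z]. The derivative at [e = 0] is [z * gauss_pdf z],
    that is [- gauss_pdf1 z], which explains the plus sign. *)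
Lemma gauss_cdf_dilate (R : realType) (z e : R) : `|e| <= 2^-1 ->
  `|gauss_cdf (z + z * e) - gauss_cdf z + e * gauss_pdf1 z|
    <= 4 * gauss_bound R * `|e| ^+ 2.
Proof.
move=> e2; have B0 := gauss_bound_ge0 R.
pose f0 e := gauss_cdf (z + z * e) - gauss_cdf z + e * gauss_pdf1 z.
pose f1 e := z * gauss_pdf (z + z * e) + gauss_pdf1 z.
rewrite -[X in `|X|]/(f0 e).
apply: (@derive_bound_exp _ f0 f1 _ e 1).
- by rewrite mulr_ge0.
- by rewrite /f0 mulr0 addr0 mul0r subrr addr0.
- move=> x; have d := is_derive_comp_affine z z x (@is_derive_gauss_cdf R).
  have -> : f0 = (fun e => gauss_cdf (z + z * e)) - cst (gauss_cdf z)
      + gauss_pdf1 z \*: @id R.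
    by apply/funext => y; rewrite /f0 !fctE /GRing.scale /=; congr (_ - _ + _); rewrite mulrC.
  by apply: is_derive_eq; rewrite /GRing.scale /= /f1; ring.
- move=> y ye; apply: (@derive_bound_exp _ f1
      (fun e => z * (z * gauss_pdf1 (z + z * e))) _ y 0).
  + by rewrite mulr_ge0.
  + by rewrite /f1 mulr0 addr0 /gauss_pdf1 subrr.
  + move=> x; have d := is_derive_comp_affine z z x (@is_derive_gauss_pdf R).
    have -> : f1 = z \*: (fun e => gauss_pdf (z + z * e)) + cst (gauss_pdf1 z) by [].
    by apply: is_derive_eq; rewrite /GRing.scale /=; ring.
  + move=> x xy; rewrite expr0 mulr1 mulrA.
    have x2 : 2^-1 <= 1 + x.
      have : `|x| <= 2^-1 by apply: le_trans xy _; exact: le_trans e2.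
      by rewrite ler_norml => /andP[? _]; lra.
    set w := z + z * x; have zw : z = w / (1 + x) by rewrite /w; field; lra.
    (* In terms of the dilated point [w] the factor z^2 is absorbed by the Gaussian decay; [1 + x]
       is at least 1/2, whence the constant 4. *)
    have -> : z * z * gauss_pdf1 w = - (1 + x) ^- 2 * (w ^+ 3 * gauss_pdf w).
      by rewrite zw /gauss_pdf1; field; lra.
    rewrite normrM ler_pM //.
      rewrite normrN ger0_norm ?invr_ge0 ?sqr_ge0 //.
      rewrite -[4]invrK lef_pV2 ?posrE ?exprn_gt0 //; [|lra].
      have -> : 4^-1 = 2^-1 ^+ 2 :> R by field.
      by rewrite lerXn2r ?nnegrE //; lra.
    rewrite normrM normrX (ger0_norm (gauss_pdf_ge0 w)).
    exact: gauss_pdf_norm_bound.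
Qed.

(** The prefactor is the ratio of the squared scales s^2 / s'^2 in the corrector of [smooth_ind].
    The derivative in [e] is (1 + e) times w^3 phi(w) - 3 w phi(w) at the dilated point w, hence at
    most 3/2 times 4 gauss bounds. *)
Lemma gauss_pdf1_dilate (R : realType) (z e : R) : `|e| <= 2^-1 ->
  `|(1 + e) ^+ 2 * gauss_pdf1 (z + z * e) - gauss_pdf1 z|
    <= 6 * gauss_bound R * `|e|.
Proof.
move=> e2; have B0 := gauss_bound_ge0 R.
pose g e := (1 + e) ^+ 2 * gauss_pdf1 (z + z * e).
pose g' e := 2 * (1 + e) * gauss_pdf1 (z + z * e) +
  (1 + e) ^+ 2 * (z * gauss_pdf2 (z + z * e)).
have -> : gauss_pdf1 z = g 0 by rewrite /g mulr0 !addr0 expr1n mul1r.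
apply: (@derive_bound _ g g').
- move=> x; have d := is_derive_comp_affine z z x (@is_derive_gauss_pdf1 R).
  have d1 : is_derive x 1 (cst 1 + @id R) 1 by apply: is_derive_eq; rewrite add0r.
  have -> : g = (cst 1 + @id R) ^+ 2 * (fun e => gauss_pdf1 (z + z * e)) by [].
  by apply: is_derive_eq; rewrite /GRing.scale /= !fctE /g'; ring.
- move=> x xe; have : `|x| <= 2^-1 by exact: le_trans e2.
  rewrite ler_norml => /andP[x1 x2].
  rewrite /g'; set w := z + z * x.
  have -> : (1 + x) ^+ 2 * (z * gauss_pdf2 w) =
    (1 + x) * (w ^+ 3 * gauss_pdf w) - (1 + x) * (w * gauss_pdf w).
    by rewrite /gauss_pdf2 /w; ring.
  have w1 := gauss_pdf1_bound w.
  have w3 : `|w ^+ 3 * gauss_pdf w| <= gauss_bound R.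
    rewrite normrM normrX (ger0_norm (gauss_pdf_ge0 w)); exact: gauss_pdf_norm_bound.
  move: w1 w3; rewrite /gauss_pdf1 normrN !ler_norml => /andP[a1 a2] /andP[b1 b2].
  move: (w * gauss_pdf w) (w ^+ 3 * gauss_pdf w) (gauss_bound R) B0 a1 a2 b1 b2 => a b B *.
  by apply/andP; split; nra.
Qed.

Lemma gauss_cdf_ge0 (R : realType) (x : R) : 0 <= gauss_cdf x.
Proof. exact: fine_ge0. Qed.

Lemma gauss_cdfE (R : realType) (x : R) :
  normal_prob (0 : R) 1 `]-oo, x] = (gauss_cdf x)%:E.
Proof. by rewrite /gauss_cdf fineK // fin_num_measure. Qed.

Lemma gauss_cdf_le1 (R : realType) (x : R) : gauss_cdf x <= 1.
Proof. by rewrite -lee_fin -gauss_cdfE probability_le1. Qed.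

Lemma gauss_cdf_nondecreasing (R : realType) (x y : R) :
  x <= y -> gauss_cdf x <= gauss_cdf y.
Proof.
by move=> xy; rewrite -lee_fin -!gauss_cdfE le_measure ?inE //; exact: subitvPr.
Qed.

(** The limits of a distribution function at infinity are stated for random variables; under the
    normal law the identity has [gauss_cdf] as its distribution function. *)
Definition id_RV (R : realType) : measurableTypeR R -> R := idfun.

HB.instance Definition _ (R : realType) :=
  @isMeasurableFun.Build _ _ _ _ (@id_RV R) (@measurable_id _ _ setT).

Lemma gauss_cdf_tails (R : realType) (e : R) : 0 < e ->
  exists K : R, [/\ 0 < K, gauss_cdf (- K) <= e & 1 - e <= gauss_cdf K].
Proof.
move=> e0; pose P : probability _ R := normal_prob (0 : R) 1.
pose X : {RV P >-> R} := @id_RV R.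
have /fine_cvgP[_ /cvgrPdist_le /(_ _ e0)[K1 [_ H1]]] := cvg_cdfNy0 X.
have /fine_cvgP[_ /cvgrPdist_le /(_ _ e0)[K2 [_ H2]]] := cvg_cdfy1 X.
(* The added units make [- K < K1] and [K2 < K] strict, as the neighbourhoods of infinity
   require. *)
exists (Num.max 1 (Num.max (1 - K1) (1 + K2))); set K := Num.max _ _.
have [k0 k1 k2] : [/\ 1 <= K, 1 - K1 <= K & 1 + K2 <= K].
  by rewrite /K !le_max !lexx !orbT.
split; first lra.
- have := H1 (- K) ltac:(lra); rewrite /= sub0r normrN; apply: le_trans.
  exact: ler_norm.
- have := H2 K ltac:(lra); rewrite /= ler_norml => /andP[_].
  rewrite /cdf /distribution /pushforward /= -/(gauss_cdf K) => ?; lra.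
Qed.

(** * The transition operator of an additive functional *)

Definition kstep (R : realType) (T : finType) (p d : T -> T -> R)
    (F : R -> T -> R) (m : R) (u : T) : R :=
  \sum_v p u v * F (m + d u v) v.

Definition stoch_kernel (R : realType) (T : finType) (p : T -> T -> R) : Prop :=
  (forall u v, 0 <= p u v) /\ (forall u, \sum_v p u v = 1).

Lemma kstep_cst (R : realType) (T : finType) (p d : T -> T -> R) (a : R) :
  stoch_kernel p -> kstep p d (fun _ _ => a) = fun _ _ => a.
Proof.
move=> [_ p1]; apply/funext => m; apply/funext => u.
by rewrite /kstep -mulr_suml p1 mul1r.
Qed.

Lemma kstepD (R : realType) (T : finType) (p d : T -> T -> R)
    (F G : R -> T -> R) :
  kstep p d (fun m u => F m u + G m u) =
  fun m u => kstep p d F m u + kstep p d G m u.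
Proof.
apply/funext => m; apply/funext => u; rewrite /kstep -big_split /=.
by apply: eq_bigr => v _; rewrite mulrDr.
Qed.

Lemma iter_kstep_shift (R : realType) (T : finType) (p d : T -> T -> R)
    (F : R -> T -> R) (a : R) (n : nat) : stoch_kernel p ->
  iter n (kstep p d) (fun m u => F m u + a) =
  fun m u => iter n (kstep p d) F m u + a.
Proof.
by move=> sp; elim: n => [//|n IH]; rewrite iterS IH kstepD kstep_cst.
Qed.

Lemma kstepZ (R : realType) (T : finType) (p d : T -> T -> R)
    (F : R -> T -> R) (a : R) :
  kstep p d (fun m u => a * F m u) = fun m u => a * kstep p d F m u.
Proof.
apply/funext => m; apply/funext => u; rewrite /kstep mulr_sumr.
by apply: eq_bigr => v _; rewrite mulrCA.
Qed.

Lemma iter_kstepZ (R : realType) (T : finType) (p d : T -> T -> R)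
    (F : R -> T -> R) (a : R) (n : nat) :
  iter n (kstep p d) (fun m u => a * F m u) =
  fun m u => a * iter n (kstep p d) F m u.
Proof. by elim: n => [//|n IH]; rewrite iterS IH kstepZ. Qed.

Lemma kstep_le (R : realType) (T : finType) (p d : T -> T -> R)
    (F G : R -> T -> R) : stoch_kernel p ->
  (forall m u, F m u <= G m u) ->
  forall m u, kstep p d F m u <= kstep p d G m u.
Proof.
by move=> [p0 _] FG m u; apply: ler_sum => v _; exact: ler_wpM2l.
Qed.

Lemma iter_kstep_le (R : realType) (T : finType) (p d : T -> T -> R)
    (F G : R -> T -> R) (n : nat) : stoch_kernel p ->
  (forall m u, F m u <= G m u) ->
  forall m u, iter n (kstep p d) F m u <= iter n (kstep p d) G m u.
Proof.
by move=> sp FG; elim: n => [//|n IH] m u; exact: kstep_le.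
Qed.

(** Averaging contracts the supremum norm, so errors made in successive steps only add up. *)
Lemma kstep_dist (R : realType) (T : finType) (p d : T -> T -> R)
    (F G : R -> T -> R) (a : R) : stoch_kernel p ->
  (forall m u, `|F m u - G m u| <= a) ->
  forall m u, `|kstep p d F m u - kstep p d G m u| <= a.
Proof.
move=> [p0 p1] FG m u; rewrite /kstep -sumrB; apply: le_trans (ler_norm_sum _ _ _) _.
rewrite -[leRHS]mul1r -(p1 u) mulr_suml; apply: ler_sum => v _.
by rewrite -mulrBr normrM (ger0_norm (p0 _ _)) ler_wpM2l.
Qed.

(** * Exponential moments and the Chernoff-Azuma bound *)

(** From exp(-x) >= 1 - x one gets exp x <= 1/(1 - x), and (1 - x)(1 + x + 2x^2) = 1 + x^2 (1 - 2x)
    is at least 1 for x <= 1/2. *)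
Lemma expR_le_quadratic (R : realType) (x : R) :
  `|x| <= 2^-1 -> expR x <= 1 + x + 2 * x ^+ 2.
Proof.
rewrite ler_norml => /andP[x1 x2].
have := expR_ge1Dx (- x); rewrite expRN => H.
have e0 := expR_gt0 x; have x1' : 0 < 1 - x by lra.
have : expR x <= (1 - x)^-1 by rewrite -[leLHS]invrK lef_pV2 ?posrE ?invr_gt0.
move/le_trans; apply; rewrite -[leLHS]mul1r ler_pdivrMr //.
have := sqr_ge0 x; rewrite expr2; nra.
Qed.

(** In the quadratic bound for exp(l d) the linear term averages to 0, leaving the factor 1 + 2 (l
    D)^2. *)
Lemma kstep_expR (R : realType) (T : finType) (p d : T -> T -> R) (D l : R) :
  stoch_kernel p -> (forall u, \sum_v p u v * d u v = 0) ->
  (forall u v, `|d u v| <= D) -> `|l| * D <= 2^-1 ->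
  forall m u, kstep p d (fun m _ => expR (l * m)) m u <=
    expR (2 * (l * D) ^+ 2) * expR (l * m).
Proof.
move=> [p0 p1] pd dD lD m u.
apply: (@le_trans _ _ (expR (l * m) * \sum_v (p u v * (1 + 2 * (l * D) ^+ 2)
   + l * (p u v * d u v)))).
  rewrite mulr_sumr; apply: ler_sum => v _; rewrite mulrDr expRD.
  rewrite mulrCA ler_wpM2l ?expR_ge0 //.
  have -> : l * (p u v * d u v) = p u v * (l * d u v) by ring.
  rewrite -mulrDr ler_wpM2l //.
  have ld : `|l * d u v| <= `|l| * D by rewrite normrM ler_wpM2l.
  apply: le_trans (expR_le_quadratic (le_trans ld lD)) _.
  rewrite addrAC lerD2r lerD2l ler_pM2l //.
  rewrite -[leLHS]real_normK ?num_real // -[leRHS]real_normK ?num_real //.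
  rewrite lerXn2r ?nnegrE // (le_trans ld) // normrM ler_wpM2l //.
  exact: ler_norm.
rewrite big_split /= -mulr_sumr pd mulr0 addr0 -mulr_suml p1 mul1r mulrC.
by rewrite ler_wpM2r ?expR_ge0 // expR_ge1Dx.
Qed.

Lemma iter_kstep_expR (R : realType) (T : finType) (p d : T -> T -> R)
    (D l : R) (n : nat) :
  stoch_kernel p -> (forall u, \sum_v p u v * d u v = 0) ->
  (forall u v, `|d u v| <= D) -> `|l| * D <= 2^-1 ->
  forall m u, iter n (kstep p d) (fun m _ => expR (l * m)) m u <=
    expR (2 * (l * D) ^+ 2) ^+ n * expR (l * m).
Proof.
move=> sp pd dD lD; elim: n => [|n IH] m u; first by rewrite expr0 mul1r.
rewrite iterS; apply: (le_trans (kstep_le d sp IH m u)).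
rewrite kstepZ /= (exprSr _ n) -[leRHS]mulrA.
by rewrite ler_wpM2l ?exprn_ge0 ?expR_ge0 ?kstep_expR.
Qed.

(* Chernoff bound with the exponent l = e / (4 D^2). *)
Lemma azuma (R : realType) (T : finType) (p d : T -> T -> R) (D e : R)
    (n : nat) :
  stoch_kernel p -> (forall u, \sum_v p u v * d u v = 0) ->
  (forall u v, `|d u v| <= D) -> 0 < e -> e <= D ->
  forall u, iter n (kstep p d) (fun m _ => (n%:R * e <= m)%R%:R) 0 u <=
    expR (- (e ^+ 2 / (8 * D ^+ 2))) ^+ n.
Proof.
move=> sp pd dD e0 eD u; have D0 : 0 < D by exact: lt_le_trans eD.
pose l := e / (4 * D ^+ 2).
have l0 : 0 < l by rewrite divr_gt0 // mulr_gt0 // exprn_gt0.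
have lD : `|l| * D <= 2^-1.
  rewrite gtr0_norm // /l; have -> : e / (4 * D ^+ 2) * D = (e / D) / 4.
    by field; rewrite gt_eqF.
  have : e / D <= 1 by rewrite ler_pdivrMr ?mul1r.
  by move=> ?; lra.
have le1 m (v : T) : (n%:R * e <= m)%R%:R <= expR (- (l * (n%:R * e))) * expR (l * m) :> R.
  rewrite -expRD; have [H|H] := leP (n%:R * e) m; last exact: expR_ge0.
  by rewrite -[leLHS]expR0 ler_expR addrC -mulrN -mulrDr mulr_ge0 ?subr_ge0 // ltW.
apply: (le_trans (iter_kstep_le d n sp le1 0 u)); rewrite iter_kstepZ.
have := iter_kstep_expR n sp pd dD lD 0 u; rewrite mulr0 expR0 mulr1 => H.
apply: (le_trans (ler_wpM2l (expR_ge0 _) H)).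
(* The exponent is n (2 l^2 D^2 - l e), which equals - n e^2 / (8 D^2) for this [l]. *)
rewrite -!expRM_natl -expRD ler_expR /l le_eqVlt; apply/orP; left; apply/eqP.
by field; rewrite gt_eqF.
Qed.

(* The Gaussian smoothing G_s(m) = Phi((c - m) / s) of the indicator of
   m <= c solves the heat equation in (s^2, m); the second summand is the
   corrector h G_s'' / 2 that averages the conditional variance. *)
Definition smooth_ind (R : realType) (T : finType) (h : T -> R) (c s m : R)
    (u : T) : R :=
  gauss_cdf ((c - m) / s) + h u / 2 * (gauss_pdf1 ((c - m) / s) / s ^+ 2).

(** The four terms come from the cubic Taylor remainder, the variation of the corrector along a
    step, the dilation of the distribution function (10 = 6 + 4) and the dilation of the corrector
    (3 = 6 / 2). *)
Definition clt_const (R : realType) (D H s2 : R) : R :=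
  gauss_bound R * (D ^+ 3 + H * D + 10 * s2 ^+ 2 + 3 * H * s2).

(** With r = s/s' one has r = (1 + k)^(-1/2), so e = r - 1 is -k/2 to first order. The error is
    computed exactly: (k/2 + e) 2 r^2 = (1 - r)^2 (1 + 2r), where r^2 >= 1/2 and 1 - r <= k. *)
Lemma dilation_ratio (R : realType) (s s' s2 : R) : 0 < s -> 0 < s' ->
  0 <= s2 -> s' ^+ 2 = s ^+ 2 + s2 -> s2 <= s ^+ 2 ->
  let k := s2 / s ^+ 2 in let e := s / s' - 1 in
  [/\ `|e| <= 2^-1, `|e| <= k & `|k / 2 + e| <= 6 * k ^+ 2].
Proof.
move=> s0 s'0 s20 s's s2s k e; pose r := s / s'.
have r0 : 0 < r by rewrite divr_gt0.
have ss' : s <= s' by rewrite -ler_sqr ?nnegrE ?(ltW s0) ?(ltW s'0) // s's lerDl.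
have r1 : r <= 1 by rewrite ler_pdivrMr // mul1r.
have kE : k = r ^- 2 - 1.
  have -> : k = (s' ^+ 2 - s ^+ 2) / s ^+ 2 by rewrite s's addrAC subrr add0r.
  by rewrite /r; field; rewrite !gt_eqF.
have k1 : k <= 1 by rewrite ler_pdivrMr ?exprn_gt0 // mul1r.
have r2 : 2^-1 <= r ^+ 2.
  rewrite -[r ^+ 2]invrK lef_pV2 ?posrE ?invr_gt0 ?exprn_gt0 //.
  by move: k1; rewrite kE; lra.
have rh : 2^-1 <= r by nra.
have kr : k * r ^+ 2 = 1 - r ^+ 2 by rewrite kE; field; rewrite gt_eqF.
have k0 : 0 <= k by rewrite divr_ge0 // sqr_ge0.
have ek : 1 - r <= k by nra.
have eE : `|e| = 1 - r by rewrite ler0_norm ?opprB // subr_le0.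
split; rewrite ?eE //; first lra.
have E2 : (k / 2 + e) * (2 * r ^+ 2) = (1 - r) ^+ 2 * (1 + 2 * r).
  have -> : (k / 2 + e) * (2 * r ^+ 2) = k * r ^+ 2 + 2 * e * r ^+ 2 by field.
  by rewrite kr /e -/r; ring.
have p0 : 0 <= k / 2 + e.
  have r20 : 0 < 2 * r ^+ 2 by rewrite mulr_gt0 ?exprn_gt0.
  by rewrite -(pmulr_lge0 (k / 2 + e) r20) E2 mulr_ge0 ?sqr_ge0 //; lra.
rewrite ger0_norm //.
have le2 : (1 - r) ^+ 2 <= k ^+ 2 by rewrite lerXn2r ?nnegrE // subr_ge0.
apply: le_trans (_ : 6 * (1 - r) ^+ 2 <= _); last by rewrite ler_pM2l.
have := sqr_ge0 (1 - r); move: E2 p0; move: (k / 2 + e) ((1 - r) ^+ 2) => a b; nra.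
Qed.

(** The first-order Taylor term averages to 0. By the Poisson equation the second-order terms and
    the averaged corrector combine through E d^2 + E h = h u + s2: the part [h u] is the corrector
    at the new scale, and [s2] accounts for the dilation from [s] to [s']. *)
Lemma clt_step (R : realType) (T : finType) (p d : T -> T -> R) (h : T -> R)
    (D H s2 : R) :
  stoch_kernel p -> (forall u, \sum_v p u v * d u v = 0) ->
  (forall u, h u - \sum_v p u v * h v = \sum_v p u v * d u v ^+ 2 - s2) ->
  (forall u v, `|d u v| <= D) -> (forall u, `|h u| <= H) -> 0 <= s2 ->
  forall c s s' m u, 1 <= s -> 0 < s' -> s' ^+ 2 = s ^+ 2 + s2 ->
  s2 <= s ^+ 2 ->
  `|kstep p d (smooth_ind h c s) m u - smooth_ind h c s' m u|
    <= clt_const D H s2 / s ^+ 3.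
Proof.
move=> [p0 p1] pd ph dD hH s20 c s s' m u s1 s'0 s's s2s.
have s0 : 0 < s by lra.
have [e1 e2 e3] := dilation_ratio s0 s'0 s20 s's s2s.
set k := s2 / s ^+ 2 in e2 e3; set e := s / s' - 1 in e1 e2 e3.
set z := (c - m) / s; set B := gauss_bound R.
have B0 : 0 <= B := gauss_bound_ge0 R.
have D0 : 0 <= D by exact: le_trans (dD u u).
have H0 : 0 <= H by exact: le_trans (hH u).
pose w v := - (d u v / s).
pose T1 v := gauss_cdf (z + w v) - gauss_cdf z - w v * gauss_pdf z
  - w v ^+ 2 / 2 * gauss_pdf1 z.
pose T2 v := gauss_pdf1 (z + w v) - gauss_pdf1 z.
pose E1 := gauss_cdf (z + z * e) - gauss_cdf z + e * gauss_pdf1 z.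
pose E2 := (1 + e) ^+ 2 * gauss_pdf1 (z + z * e) - gauss_pdf1 z.
have ze : (c - m) / s' = z + z * e by rewrite /z /e; field; rewrite !gt_eqF.
have se : s' ^- 2 = (1 + e) ^+ 2 / s ^+ 2 by rewrite /e; field; rewrite !gt_eqF.
have zw v : (c - (m + d u v)) / s = z + w v by rewrite /z /w; field; rewrite gt_eqF.
(* An exact identity: [T1], [T2] are the Taylor and Lipschitz remainders of the step, [E1], [E2]
   those of the change of scale, and [k / 2 + e] is the mismatch of the two scalings. *)
have decomp : kstep p d (smooth_ind h c s) m u - smooth_ind h c s' m u =
  \sum_v p u v * (T1 v + h v / (2 * s ^+ 2) * T2 v) +
  ((k / 2 + e) * gauss_pdf1 z - E1 - h u / (2 * s ^+ 2) * E2).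
  have -> : kstep p d (smooth_ind h c s) m u =
    \sum_v p u v * (T1 v + h v / (2 * s ^+ 2) * T2 v) +
    ((\sum_v p u v) * gauss_cdf z - (\sum_v p u v * d u v) * (gauss_pdf z / s) +
     (\sum_v p u v * d u v ^+ 2) * (gauss_pdf1 z / (2 * s ^+ 2)) +
     (\sum_v p u v * h v) * (gauss_pdf1 z / (2 * s ^+ 2))).
    rewrite !mulr_suml -sumrB -!big_split /=; apply: eq_bigr => v _.
    rewrite /smooth_ind zw /T1 /T2 /w; field; rewrite gt_eqF //.
  rewrite p1 pd -addrA; congr (_ + _).
  have -> : \sum_v p u v * h v = h u - (\sum_v p u v * d u v ^+ 2 - s2).
    by rewrite -ph; ring.
  rewrite /smooth_ind ze se /E1 /E2 /k; field; rewrite gt_eqF //.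
rewrite decomp.
have bT1 v : `|T1 v| <= B * (D / s) ^+ 3.
  apply: le_trans (gauss_cdf_taylor z (w v)) _; rewrite ler_wpM2l //.
  rewrite lerXn2r ?nnegrE ?divr_ge0 ?(ltW s0) // /w normrN normrM (gtr0_norm (x := s^-1)) ?invr_gt0 //.
  by rewrite ler_pM2r ?invr_gt0.
have bT2 v : `|T2 v| <= B * (D / s).
  apply: le_trans (gauss_pdf1_lipschitz z (w v)) _; rewrite ler_wpM2l //.
  rewrite /w normrN normrM (gtr0_norm (x := s^-1)) ?invr_gt0 //.
  by rewrite ler_pM2r ?invr_gt0.
have hs v : `|h v / (2 * s ^+ 2)| <= H / (2 * s ^+ 2).
  have ? : 0 < (2 * s ^+ 2)^-1 by rewrite invr_gt0 mulr_gt0 ?exprn_gt0.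
  by rewrite normrM (gtr0_norm (x := _^-1)) // ler_pM2r.
have bsum : `|\sum_v p u v * (T1 v + h v / (2 * s ^+ 2) * T2 v)| <=
    B * (D / s) ^+ 3 + H / (2 * s ^+ 2) * (B * (D / s)).
  apply: le_trans (ler_norm_sum _ _ _) _.
  rewrite -[leRHS]mul1r -[X in _ <= X * _](p1 u) mulr_suml; apply: ler_sum => v _.
  rewrite normrM (ger0_norm (p0 _ _)) ler_wpM2l //.
  apply: le_trans (ler_normD _ _) _; apply: lerD; first exact: bT1.
  rewrite normrM; apply: ler_pM; [by []|by []|exact: hs|exact: bT2].
have k0 : 0 <= k by rewrite divr_ge0 // sqr_ge0.
have b1 : `|(k / 2 + e) * gauss_pdf1 z| <= 6 * k ^+ 2 * B.
  by rewrite normrM ler_pM // gauss_pdf1_bound.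
have b2 : `|E1| <= 4 * B * k ^+ 2.
  apply: le_trans (gauss_cdf_dilate z e1) _.
  apply: ler_wpM2l; first exact: mulr_ge0.
  by rewrite lerXn2r ?nnegrE.
have b3 : `|h u / (2 * s ^+ 2) * E2| <= H / (2 * s ^+ 2) * (6 * B * k).
  rewrite normrM ler_pM // (le_trans (gauss_pdf1_dilate z e1)) //.
  by apply: ler_wpM2l => //; exact: mulr_ge0.
have ler4 (a b : R) : 0 <= a -> a / s ^+ 4 <= a / s ^+ 3.
  move=> a0; rewrite ler_wpM2l // lef_pV2 ?posrE ?exprn_gt0 //.
  by rewrite -[leLHS]mul1r (exprS s 3) ler_wpM2r // exprn_ge0 // ltW.
apply: le_trans (ler_normD _ _) _.
apply: le_trans (lerD bsum (le_trans (ler_normB _ _) (lerD (le_trans (ler_normB _ _) (lerD b1 b2)) b3))) _.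
have -> : B * (D / s) ^+ 3 + H / (2 * s ^+ 2) * (B * (D / s)) +
  (6 * k ^+ 2 * B + 4 * B * k ^+ 2 + H / (2 * s ^+ 2) * (6 * B * k)) =
  (B * (D ^+ 3 + H * D / 2)) / s ^+ 3 + (B * (10 * s2 ^+ 2 + 3 * H * s2)) / s ^+ 4.
  by rewrite /k; field; rewrite gt_eqF.
have b4 : 0 <= B * (10 * s2 ^+ 2 + 3 * H * s2).
  by rewrite mulr_ge0 // addr_ge0 // mulr_ge0 // ?sqr_ge0 // mulr_ge0.
apply: le_trans (lerD (lexx _) (ler4 _ 0 b4)) _.
rewrite -mulrDl ler_wpM2r ?invr_ge0 ?exprn_ge0 ?(ltW s0) //.
rewrite /clt_const -/B -mulrDr ler_wpM2l //.
by have := mulr_ge0 H0 D0; lra.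
Qed.

Lemma clt_const_ge0 (R : realType) (D H s2 : R) :
  0 <= D -> 0 <= H -> 0 <= s2 -> 0 <= clt_const D H s2.
Proof.
move=> D0 H0 s20; rewrite mulr_ge0 ?gauss_bound_ge0 //.
by rewrite !addr_ge0 ?mulr_ge0 ?exprn_ge0.
Qed.

(** Telescoping over the scales: each step adds [s2] to the squared scale, and since scales only
    grow, every one-step error is at most the one at the initial [s]. *)
Lemma clt_iter (R : realType) (T : finType) (p d : T -> T -> R) (h : T -> R)
    (D H s2 : R) :
  stoch_kernel p -> (forall u, \sum_v p u v * d u v = 0) ->
  (forall u, h u - \sum_v p u v * h v = \sum_v p u v * d u v ^+ 2 - s2) ->
  (forall u v, `|d u v| <= D) -> (forall u, `|h u| <= H) -> 0 <= s2 ->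
  forall c s n m u, 1 <= s -> s2 <= s ^+ 2 ->
  `|iter n (kstep p d) (smooth_ind h c s) m u
     - smooth_ind h c (Num.sqrt (s ^+ 2 + n%:R * s2)) m u|
    <= n%:R * (clt_const D H s2 / s ^+ 3).
Proof.
move=> sp pd ph dD hH s20 c s n m u s1 s2s.
have s0 : 0 < s by lra.
elim: n m u => [|n IH] m u.
  by rewrite mul0r addr0 sqrtr_sqr (gtr0_norm s0) subrr normr0 mul0r.
set s' := Num.sqrt (s ^+ 2 + n%:R * s2).
have ns2 : 0 <= n%:R * s2 by rewrite mulr_ge0.
have s'2 : s' ^+ 2 = s ^+ 2 + n%:R * s2 by rewrite sqr_sqrtr // addr_ge0 ?sqr_ge0.
have ss' : s <= s'.
  by rewrite -ler_sqr ?nnegrE ?sqrtr_ge0 ?(ltW s0) // s'2 lerDl.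
set s'' := Num.sqrt (s ^+ 2 + n.+1%:R * s2).
have n1s2 : 0 <= n.+1%:R * s2 by rewrite mulr_ge0.
have s''2 : s'' ^+ 2 = s' ^+ 2 + s2.
  by rewrite sqr_sqrtr ?addr_ge0 ?sqr_ge0 // s'2 -natr1; ring.
have s''0 : 0 < s'' by rewrite sqrtr_gt0 ltr_wpDr // exprn_gt0.
rewrite iterS -(subrKA (kstep p d (smooth_ind h c s') m u)).
apply: le_trans (ler_normD _ _) _; rewrite -natr1 mulrDl mul1r lerD //.
  by apply: kstep_dist.
have s2s' : s2 <= s' ^+ 2 by rewrite s'2 (le_trans s2s) // lerDl.
apply: le_trans (clt_step sp pd ph dD hH s20 c m u (le_trans s1 ss') s''0 s''2 s2s') _.
rewrite ler_wpM2l ?clt_const_ge0 //.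
- exact: le_trans (dD u u).
- exact: le_trans (hH u).
- rewrite lef_pV2 ?posrE ?exprn_gt0 ?lerXn2r ?nnegrE ?(ltW s0) //.
  + exact: sqrtr_ge0.
  + exact: lt_le_trans ss'.
Qed.

(** The 3 is 2 + 1: the quadratic dilation error 4 e^2 is at most 2 |e|, and the linear term costs
    one more |e|. *)
Lemma gauss_cdf_perturb (R : realType) (y a e : R) : `|e| <= 2^-1 ->
  `|gauss_cdf ((y + a) * (1 + e)) - gauss_cdf y|
    <= gauss_bound R * (3 * `|e| + `|a|).
Proof.
move=> e2; set z := y + a; have B0 := gauss_bound_ge0 R.
have -> : z * (1 + e) = z + z * e by ring.
rewrite -(subrKA (gauss_cdf z)); apply: le_trans (ler_normD _ _) _.
rewrite mulrDr lerD ?gauss_cdf_lipschitz //.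
have -> : gauss_cdf (z + z * e) - gauss_cdf z =
  gauss_cdf (z + z * e) - gauss_cdf z + e * gauss_pdf1 z - e * gauss_pdf1 z by ring.
apply: le_trans (ler_normB _ _) _.
apply: le_trans (lerD (gauss_cdf_dilate z e2) (lexx _)) _.
rewrite normrM.
have := ler_wpM2l (normr_ge0 e) (gauss_pdf1_bound z).
have : `|e| ^+ 2 <= 2^-1 * `|e| by rewrite expr2 ler_wpM2r.
move: (`|gauss_pdf1 z|) (`|e|) (normr_ge0 e) (gauss_bound R) B0 => g b b0 B B0 H1 H2.
have := ler_wpM2l B0 H1; lra.
Qed.

(** Up to Gaussian tails and the corrector, the indicator of [m <= c] lies between smoothings of
    width [s] centred at [c - K * s] and [c + K * s]. For [s] a small multiple of [q], n steps bring
    the scale to a value close to [q], so both bounds come close to Phi(c / q). Uniformity in [c]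
    later permits thresholds that depend on [n]. *)
Lemma clt_uniform (R : realType) (T : finType) (p d : T -> T -> R) (h : T -> R)
    (D H s2 : R) :
  stoch_kernel p -> (forall u, \sum_v p u v * d u v = 0) ->
  (forall u, h u - \sum_v p u v * h v = \sum_v p u v * d u v ^+ 2 - s2) ->
  (forall u v, `|d u v| <= D) -> (forall u, `|h u| <= H) -> 0 < s2 ->
  forall eta, 0 < eta -> exists N, forall n c u, (N <= n)%N ->
  `|iter n (kstep p d) (fun m _ => (m <= c)%R%:R) 0 u
     - gauss_cdf (c / Num.sqrt (n%:R * s2))| <= eta.
Proof.
move=> sp pd ph dD hH s20 eta eta0.
have [K [K0 KN KP]] := @gauss_cdf_tails R (eta / 4) ltac:(lra).
set B := gauss_bound R; have B0 : 0 <= B := gauss_bound_ge0 R.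
(* Chosen so that shifting the centre by [K * s] and replacing the final scale by [q] together cost
   at most [eta / 4]. *)
pose del := Num.min 1 (eta / (4 * ((B + 1) * (3 + K)))).
have BK0 : 0 < (B + 1) * (3 + K) by rewrite mulr_gt0; lra.
have del0 : 0 < del by rewrite lt_min ltr01 divr_gt0 // mulr_gt0.
have del1 : del <= 1 by rewrite ge_min lexx.
have delB : B * (3 * del ^+ 2 + K * del) <= eta / 4.
  have : del * ((B + 1) * (3 + K)) <= eta / 4.
    rewrite -ler_pdivlMr //.
    have -> : eta / 4 / ((B + 1) * (3 + K)) = eta / (4 * ((B + 1) * (3 + K))).
      by field; rewrite gt_eqF //=; lra.
    by rewrite ge_min lexx orbT.
  apply: le_trans; have : del ^+ 2 <= del by rewrite expr2 ler_piMl ?(ltW del0).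
  move=> d2; have := ler_wpM2l B0 d2; have := mulr_gt0 del0 K0.
  have := mulr_ge0 B0 (ltW del0); nra.
case: (pickP (fun _ : T => true)) => [u0 _|noT]; last first.
  by exists 0%N => n c u; have := noT u.
have D0 : 0 <= D by exact: le_trans (dD u0 u0).
have H0 : 0 <= H by exact: le_trans (hH u0).
set C := clt_const D H s2.
have C0 : 0 <= C by apply: clt_const_ge0 => //; exact: ltW.
(* [A / s] bounds the accumulated error of the n steps plus the correctors at the first and last
   scales. *)
pose A := C / (del ^+ 2 * s2) + H * B.
have ds0 : 0 < del ^+ 2 * s2 by apply: mulr_gt0 => //; exact: exprn_gt0.
have A0 : 0 <= A.
  by apply: addr_ge0; [apply: divr_ge0 => //; exact: ltW|exact: mulr_ge0].
(* A scale [s >= M] satisfies [1 <= s], [s2 <= s ^+ 2] and [A / s <= eta / 2] at once. *)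
pose M := 1 + s2 + 2 * A / eta.
have M1 : 1 + s2 <= M by rewrite /M lerDl divr_ge0 ?(ltW eta0) ?mulr_ge0.
have MA : A / M <= eta / 2.
  rewrite ler_pdivrMr; last by lra.
  rewrite /M mulrDr; have -> : eta / 2 * (2 * A / eta) = A by field; rewrite gt_eqF.
  by rewrite lerDr mulr_ge0; lra.
exists (Num.truncn (M ^+ 2 / (del ^+ 2 * s2))).+1 => n c u Nn.
set q := Num.sqrt (n%:R * s2); pose s := del * q.
have n0 : 0 < n%:R * s2 by rewrite mulr_gt0 // ltr0n (leq_trans _ Nn).
have q0 : 0 < q by rewrite sqrtr_gt0.
have q2 : q ^+ 2 = n%:R * s2 by rewrite sqr_sqrtr // ltW.
have s0 : 0 < s by rewrite mulr_gt0.
have Ms : M <= s.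
  rewrite -ler_sqr ?nnegrE ?(ltW s0) //; last by lra.
  rewrite /s exprMn q2 mulrCA -ler_pdivrMr // ltW //.
  by apply: lt_le_trans (Num.Theory.truncnS_gt _) _; rewrite ler_nat.
have s1 : 1 <= s by lra.
have s2s : s2 <= s ^+ 2.
  have -> : s ^+ 2 = s * s by rewrite expr2.
  by rewrite -[leLHS]mul1r ler_pM //; lra.
have As : A / s <= eta / 2.
  by apply: le_trans MA; rewrite ler_wpM2l // lef_pV2 ?posrE //; lra.
pose s' := Num.sqrt (s ^+ 2 + n%:R * s2).
have s'2 : s' ^+ 2 = q ^+ 2 + s ^+ 2.
  by rewrite sqr_sqrtr ?addr_ge0 ?sqr_ge0 ?(ltW n0) // q2 addrC.
have s'0 : 0 < s' by rewrite sqrtr_gt0 addr_gt0 ?exprn_gt0.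
have sq : s ^+ 2 <= q ^+ 2.
  by rewrite /s exprMn ler_piMl ?sqr_ge0 // exprn_ile1 // ltW.
have [e1 e2 _] := dilation_ratio q0 s'0 (sqr_ge0 s) s'2 sq.
set e := q / s' - 1 in e1 e2.
have {}e2 : `|e| <= del ^+ 2.
  by move: e2; rewrite /s exprMn mulfK // gt_eqF // exprn_gt0.
have smooth_near c' s1' m v : s <= s1' ->
    `|smooth_ind h c' s1' m v - gauss_cdf ((c' - m) / s1')| <= H * B / (2 * s ^+ 2).
  move=> ss1; have s10 : 0 < s1' by exact: lt_le_trans ss1.
  rewrite /smooth_ind addrAC subrr add0r !normrM -mulrA.
  have -> : H * B / (2 * s ^+ 2) = H * (2^-1 * (B * s ^- 2)) by field; rewrite gt_eqF.
  rewrite ler_pM // (gtr0_norm (x := 2^-1)) ?invr_gt0 // ler_wpM2l //.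
  rewrite ler_pM // ?gauss_pdf1_bound // ger0_norm ?invr_ge0 ?sqr_ge0 //.
  by rewrite lef_pV2 ?posrE ?exprn_gt0 // lerXn2r ?nnegrE // ltW.
(* Budget: [eta / 2] for iteration and correctors, [eta / 4] for shift and final scale. The extra
   summand is reserved for the corrector in the initial comparison with the indicator, and the last
   [eta / 4] for the tails. *)
have main a : `|a| <= K * del ->
    `|iter n (kstep p d) (smooth_ind h (c + a * q) s) 0 u - gauss_cdf (c / q)|
      + H * B / (2 * s ^+ 2) <= 3 / 4 * eta.
  move=> aK; have it := clt_iter sp pd ph dD hH (ltW s20) (c + a * q) n 0 u s1 s2s.
  have ss' : s <= s'.
    by rewrite -ler_sqr ?nnegrE ?(ltW s0) ?(ltW s'0) // s'2 lerDr sqr_ge0.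
  have := smooth_near (c + a * q) s' 0 u ss'.
  have := gauss_cdf_perturb (c / q) a e1.
  have -> : (c / q + a) * (1 + e) = (c + a * q - 0) / s'.
    by rewrite /e; field; rewrite !gt_eqF.
  rewrite -/s' -/C in it *.
  have nC : n%:R * (C / s ^+ 3) = C / (del ^+ 2 * s2) / s.
    have -> : s ^+ 3 = s * (del ^+ 2 * (n%:R * s2)) by rewrite -q2 -exprMn -exprS.
    by field; rewrite !gt_eqF //=; rewrite ltr0n (leq_trans _ Nn).
  rewrite nC in it.
  have HB : H * B / (2 * s ^+ 2) <= H * B / s / 2.
    have -> : H * B / s / 2 = H * B / (2 * s) by field; rewrite gt_eqF.
    apply: ler_wpM2l; first exact: mulr_ge0.
    rewrite lef_pV2 ?posrE ?mulr_gt0 ?exprn_gt0 //.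
    by rewrite ler_pM2l // expr2 ler_peMl // ltW.
  have Be : B * (3 * `|e| + `|a|) <= eta / 4.
    by apply: le_trans delB; rewrite ler_wpM2l // lerD // ler_pM2l.
  have As' : C / (del ^+ 2 * s2) / s + H * B / s <= eta / 2 by rewrite -mulrDl.
  move=> g1 g2.
  have := ler_distD (smooth_ind h (c + a * q) s' 0 u)
    (iter n (kstep p d) (smooth_ind h (c + a * q) s) 0 u) (gauss_cdf (c / q)).
  have := ler_distD (gauss_cdf ((c + a * q - 0) / s'))
    (smooth_ind h (c + a * q) s' 0 u) (gauss_cdf (c / q)).
  by rewrite -/B in g1 *; lra.
have Kd0 : 0 <= K * del by rewrite mulr_ge0 // ltW.
have Es : K * del * q = K * s by rewrite mulrA.
rewrite ler_distl; apply/andP; split.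
- have := main (- (K * del)); rewrite normrN ger0_norm // lexx => /(_ isT).
  rewrite mulNr Es.
  have le1 m (v : T) : smooth_ind h (c - K * s) s m v +
      - (H * B / (2 * s ^+ 2) + eta / 4) <= (m <= c)%R%:R.
    have := smooth_near (c - K * s) s m v (lexx _).
    rewrite ler_distl => /andP[_].
    have [mc|mc] := leP m c.
      by have := gauss_cdf_le1 ((c - K * s - m) / s); rewrite mulr1n; lra.
    suff : gauss_cdf ((c - K * s - m) / s) <= gauss_cdf (- K) by rewrite mulr0n; lra.
    by apply: gauss_cdf_nondecreasing; rewrite ler_pdivrMr //; lra.
  have := iter_kstep_le d n sp le1 0 u; rewrite iter_kstep_shift //=.
  have := ler_norm (gauss_cdf (c / q) - iter n (kstep p d) (smooth_ind h (c - K * s) s) 0 u).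
  by rewrite distrC; lra.
- have := main (K * del); rewrite ger0_norm // lexx => /(_ isT).
  rewrite Es.
  have le1 m (v : T) : (m <= c)%R%:R <=
      smooth_ind h (c + K * s) s m v + (H * B / (2 * s ^+ 2) + eta / 4).
    have := smooth_near (c + K * s) s m v (lexx _).
    rewrite ler_distl => /andP[+ _].
    have [mc|mc] := leP m c; last first.
      by have := gauss_cdf_ge0 ((c + K * s - m) / s); rewrite mulr0n; lra.
    suff : gauss_cdf K <= gauss_cdf ((c + K * s - m) / s) by rewrite mulr1n; lra.
    by apply: gauss_cdf_nondecreasing; rewrite ler_pdivlMr //; lra.
  have := iter_kstep_le d n sp le1 0 u; rewrite iter_kstep_shift //=.
  have := ler_norm (iter n (kstep p d) (smooth_ind h (c + K * s) s) 0 u - gauss_cdf (c / q)).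
  by lra.
Qed.

(** * Additive functionals of a Markov chain *)

Definition past (Omega T : Type) (X : nat -> Omega -> T) (n : nat)
    (u : nat -> T) : set Omega :=
  [set w | forall k, (k <= n)%N -> X k w = u k].

Definition incr_sum (R : realType) (T : Type) (d : T -> T -> R) (n : nat)
    (x : nat -> T) : R := \sum_(i < n) d (x i) (x i.+1).

(** A history is an infinite sequence of which only the values up to [n] matter; the extension is
    therefore free to be constant after [n]. *)
Definition extend_past (T : Type) (n : nat) (u : nat -> T) (v : T) : nat -> T :=
  fun k => if (k <= n)%N then u k else v.

Lemma incr_sum_extend (R : realType) (T : Type) (d : T -> T -> R) (n : nat)
    (u : nat -> T) (v : T) :
  incr_sum d n.+1 (extend_past n u v) = incr_sum d n u + d (u n) v.
Proof.
rewrite /incr_sum big_ord_recr /= /extend_past leqnn ltnn; congr (_ + _).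
by apply: eq_bigr => i _; rewrite (ltnW (ltn_ord i)) ltn_ord.
Qed.

Lemma past_extend (Omega T : Type) (X : nat -> Omega -> T) (n : nat)
    (u : nat -> T) (v : T) :
  past X n.+1 (extend_past n u v) = past X n u `&` X n.+1 @^-1` [set v].
Proof.
apply/seteqP; split=> [w H|w [H1 H2] k].
  split=> [k kn|]; last by have := H n.+1 (leqnn _); rewrite /extend_past ltnn.
  by have := H k (leqW kn); rewrite /extend_past kn.
by rewrite leq_eqVlt => /orP[/eqP ->|]; rewrite /extend_past ?ltnn // ltnS => kn; rewrite kn H1.
Qed.

Lemma measure_partition (d : measure_display) (R : realType)
    (Omega : measurableType d) (Pr : probability Omega R) (T : finType)
    (Y : Omega -> T) (A : set Omega) :
  measurable A -> (forall v, measurable (Y @^-1` [set v])) ->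
  Pr A = (\sum_v Pr (A `&` Y @^-1` [set v]))%E.
Proof.
move=> mA mY; rewrite fsbig_seq ?index_enum_uniq //.
rewrite -measure_fin_bigcup //.
- congr (Pr _); apply/seteqP; split=> [w Aw|w [v _ []] //].
  by exists (Y w) => //=; rewrite mem_index_enum.
- by move=> i j _ _ [w [[_ /= <-] [_ /= <-]]].
- by move=> v _; exact: measurableI.
Qed.

Lemma measurable_finite_comp (d : measure_display) (R : realType)
    (Omega : measurableType d) (T : finType) (Y : Omega -> T) (f : T -> R) :
  (forall v, measurable (Y @^-1` [set v])) -> measurable_fun [set: Omega] (f \o Y).
Proof.
move=> mY _ B mB; rewrite setTI.
have -> : (f \o Y) @^-1` B = \bigcup_(v in [set v | B (f v)]) (Y @^-1` [set v]).
  by apply/seteqP; split=> [w Bw|w [v /= Bv Yv]]; [exists (Y w)|rewrite /= Yv].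
by apply: fin_bigcup_measurable => //; exact: finite_finset.
Qed.

Section MarkovChain.
Context (R : realType) (disp : measure_display) (Omega : measurableType disp)
  (Pr : probability Omega R) (T : finType) (X : nat -> Omega -> T)
  (P : 'M[R]_#|T|) (XP : markov_chain Pr X P).

Local Notation p := (fun u v : T => P (enum_rank u) (enum_rank v)).

Lemma markov_measurable n v : measurable (X n @^-1` [set v]).
Proof. exact: XP.1. Qed.

Lemma measurable_past n u : measurable (past X n u).
Proof.
have -> : past X n u = \bigcap_(k in `I_n.+1) (X k @^-1` [set u k]).
  by apply/seteqP; split=> [w H k kn|w H k kn]; apply: H.
by apply: fin_bigcap_measurable => // k _; exact: markov_measurable.
Qed.

Lemma measurable_incr_sum (d : T -> T -> R) n :
  measurable_fun [set: Omega] (fun w => incr_sum d n (X ^~ w)).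
Proof.
apply: measurable_sum => i.
apply: (@measurable_finite_comp _ _ _ _ (fun w => (X i w, X i.+1 w))
  (fun uv => d uv.1 uv.2)) => -[a b].
have -> : (fun w => (X i w, X i.+1 w)) @^-1` [set (a, b)] =
   X i @^-1` [set a] `&` X i.+1 @^-1` [set b].
  by apply/seteqP; split=> [w [<- <-]|w [/= <- <-]].
by apply: measurableI; exact: markov_measurable.
Qed.

Lemma prob_past_extend n u v :
  Pr (past X n.+1 (extend_past n u v)) = (Pr (past X n u) * (p (u n) v)%:E)%E.
Proof.
rewrite past_extend; have mp := measurable_past n u.
have mI : measurable (past X n u `&` X n.+1 @^-1` [set v]).
  by apply: measurableI => //; exact: markov_measurable.
(* The Markov property only speaks of pasts of positive probability; for a null past both sides
   vanish. *)
have [Pr0|Pr0] := eqVneq (Pr (past X n u)) 0%E.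
  rewrite Pr0 mul0e; apply/eqP; rewrite -measure_le0 -[leRHS]Pr0.
  by apply: le_measure; rewrite ?inE //; exact: subIsetl.
have Prgt0 : (0 < Pr (past X n u))%E by rewrite lt0e Pr0 measure_ge0.
have := XP.2 n u v Prgt0; rewrite /cond_prob -/(past X n u) setIC => H.
rewrite -(fineK (fin_num_measure Pr _ mI)) -(fineK (fin_num_measure Pr _ mp)).
rewrite -EFinM -H mulrCA divff ?mulr1 // gt_eqF // fine_gt0 // Prgt0 /=.
by rewrite -ge0_fin_numE ?fin_num_measure.
Qed.

(** The outermost [kstep] corresponds to the first transition after time [n]. Splitting on the value
    of [X n.+1] reduces to a past of length [n.+1], so the induction on [k] must range over all [n]
    and [u]. *)
Lemma prob_past_incr_sum (d : T -> T -> R) (B : set R) : measurable B ->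
  forall k n u,
  Pr (past X n u `&` [set w | B (incr_sum d (n + k) (X ^~ w))]) =
  (Pr (past X n u) *
   (iter k (kstep p d) (fun m _ => (m \in B)%:R) (incr_sum d n u) (u n))%:E)%E.
Proof.
move=> mB; elim=> [|k IH] n u.
  rewrite addn0 /=.
  have E w : past X n u w -> incr_sum d n (X ^~ w) = incr_sum d n u.
    move=> H; apply: eq_bigr => i _.
    by rewrite !H // ltnW.
  have [Bu|Bu] := boolP (incr_sum d n u \in B).
    rewrite mule1; congr (Pr _); apply/setIidPl => w /E /= ->; exact: set_mem.
  rewrite mule0 -(measure0 Pr); congr (Pr _); apply/seteqP; split=> // w [/E /= -> /mem_set].
  exact/negP.
have mE : measurable (past X n u `&` [set w | B (incr_sum d (n + k.+1) (X ^~ w))]).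
  apply: measurableI; first exact: measurable_past.
  have := @measurable_incr_sum d (n + k.+1) measurableT B mB.
  by rewrite setTI.
rewrite (measure_partition _ mE (markov_measurable n.+1)).
under eq_bigr => v _.
  rewrite setIAC -past_extend addnS -addSn IH prob_past_extend incr_sum_extend.
  rewrite /extend_past ltnn -muleA -EFinM.
  over.
rewrite -fin_num_sume_distrr ?sumEFin //.
exact: fin_num_measure (measurable_past n u).
Qed.

(** Conditioning on [X 0] gives an average over starting states, so bounds uniform in the state pass
    to any initial law. *)
Lemma prob_incr_sum (d : T -> T -> R) (B : set R) k : measurable B ->
  Pr [set w | B (incr_sum d k (X ^~ w))] =
  (\sum_v fine (Pr (X 0%N @^-1` [set v])) *
     iter k (kstep p d) (fun m _ => (m \in B)%:R) 0 v)%:E.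
Proof.
move=> mB.
have mE : measurable [set w | B (incr_sum d k (X ^~ w))].
  by have := @measurable_incr_sum d k measurableT B mB; rewrite setTI.
rewrite (measure_partition Pr mE (markov_measurable 0)) -sumEFin.
apply: eq_bigr => v _; rewrite EFinM fineK ?fin_num_measure //; last first.
  exact: markov_measurable.
have E : past X 0 (fun=> v) = X 0%N @^-1` [set v].
  by apply/seteqP; split=> [w H|w H [|//] _]; [exact: (H 0%N)|].
have := prob_past_incr_sum d mB k 0 (fun=> v).
by rewrite E setIC add0n /incr_sum big_ord0.
Qed.

Lemma prob_initial_sum1 : \sum_v fine (Pr (X 0%N @^-1` [set v])) = 1.
Proof.
apply/EFin_inj; rewrite -sumEFin -(probability_setT Pr).
rewrite (measure_partition Pr measurableT (markov_measurable 0)).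
apply: eq_bigr => v _; rewrite setTI fineK ?fin_num_measure //.
exact: markov_measurable.
Qed.

Lemma prob_incr_sum_le (d : T -> T -> R) (B : set R) k (a : R) : measurable B ->
  (forall v, iter k (kstep p d) (fun m _ => (m \in B)%:R) 0 v <= a) ->
  (Pr [set w | B (incr_sum d k (X ^~ w))] <= a%:E)%E.
Proof.
move=> mB Ba; rewrite prob_incr_sum // lee_fin -[leRHS]mul1r.
rewrite -[X in _ <= X * _]prob_initial_sum1 mulr_suml.
by apply: ler_sum => v _; apply: ler_wpM2l; [exact/fine_ge0/measure_ge0|exact: Ba].
Qed.

Lemma prob_incr_sum_near (d : T -> T -> R) (B : set R) k (a e : R) : measurable B ->
  (forall v, `|iter k (kstep p d) (fun m _ => (m \in B)%:R) 0 v - a| <= e) ->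
  `|fine (Pr [set w | B (incr_sum d k (X ^~ w))]) - a| <= e.
Proof.
move=> mB Ba; rewrite prob_incr_sum //= -[X in _ - X]mul1r -[leRHS]mul1r.
rewrite -[X in _ - X * _]prob_initial_sum1 -[X in _ <= X * _]prob_initial_sum1.
rewrite !mulr_suml -sumrB; apply: le_trans (ler_norm_sum _ _ _) _.
apply: ler_sum => v _; have q0 := fine_ge0 (measure_ge0 Pr (X 0%N @^-1` [set v])).
by rewrite -mulrBr normrM (ger0_norm q0); apply: ler_wpM2l.
Qed.

End MarkovChain.

(** * Strong law for martingale increments *)

Section MartingaleLLN.
Context (R : realType) (disp : measure_display) (Omega : measurableType disp)
  (Pr : probability Omega R) (T : finType) (X : nat -> Omega -> T)
  (P : 'M[R]_#|T|) (XP : markov_chain Pr X P).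

Local Notation p := (fun u v : T => P (enum_rank u) (enum_rank v)).

Lemma prob_incr_sum_tail (d : T -> T -> R) (D e : R) n : stoch_kernel p ->
  (forall u, \sum_v p u v * d u v = 0) -> (forall u v, `|d u v| <= D) ->
  0 < e -> e <= D ->
  (Pr [set w | `[(n%:R * e)%R, +oo[%classic (incr_sum d n (X ^~ w))]
    <= (expR (- (e ^+ 2 / (8 * D ^+ 2))) ^+ n)%R%:E)%E.
Proof.
move=> sp pd dD e0 eD; apply: (prob_incr_sum_le XP); first exact: measurable_itv.
move=> v; have -> : (fun m (_ : T) => (m \in `[(n%:R * e), +oo[%classic)%:R) =
    (fun m (_ : T) => (n%:R * e <= m)%R%:R) :> (R -> T -> R).
  by apply/funext => m; apply/funext => u; rewrite mem_setE in_itv /= andbT.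
exact: azuma.
Qed.

Lemma incr_sum_opp (d : T -> T -> R) n x :
  incr_sum (fun u v => - d u v) n x = - incr_sum d n x.
Proof. by rewrite /incr_sum sumrN. Qed.

Definition deviation (d : T -> T -> R) (e : R) (n : nat) : set Omega :=
  [set w | n%:R * e <= `|incr_sum d n (X ^~ w)|].

Lemma deviationE (d : T -> T -> R) (e : R) (n : nat) : deviation d e n =
  [set w | `[(n%:R * e), +oo[%classic (incr_sum d n (X ^~ w))] `|`
  [set w | `[(n%:R * e), +oo[%classic (incr_sum (fun u v => - d u v) n (X ^~ w))].
Proof.
apply/seteqP; split=> [w|w]; rewrite /deviation /= !in_itv /= !andbT incr_sum_opp ler_normr.
  by move=> /orP.
by move=> H; apply/orP.
Qed.

Lemma measurable_deviation (d : T -> T -> R) (e : R) (n : nat) :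
  measurable (deviation d e n).
Proof.
rewrite deviationE; apply: measurableU; rewrite -[X in measurable X]setTI;
by apply: (measurable_incr_sum XP) => //; exact: measurable_itv.
Qed.

(** Borel-Cantelli: the bound on the two tails is summable, with sum 2 / (1 - r). *)
Lemma deviation_negligible (d : T -> T -> R) (D e : R) : stoch_kernel p ->
  (forall u, \sum_v p u v * d u v = 0) -> (forall u v, `|d u v| <= D) ->
  0 < e -> e <= D -> Pr.-negligible (lim_sup_set (deviation d e)).
Proof.
move=> sp pd dD e0 eD.
have mF k : measurable (deviation d e k) by exact: measurable_deviation.
apply/negligibleP.
  by apply: bigcap_measurable => // k _; exact: bigcup_measurable.
apply: lim_sup_set_cvg0 => //.
set r := expR (- (e ^+ 2 / (8 * D ^+ 2))).
have D0 : 0 < D by exact: lt_le_trans eD.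
have r0 : 0 < r by exact: expR_gt0.
have r1 : `|r| < 1.
  rewrite gtr0_norm // /r -expR0 ltr_expR oppr_lt0 divr_gt0 ?exprn_gt0 //.
  by rewrite mulr_gt0 // exprn_gt0.
have Fr n : (Pr (deviation d e n) <= (geometric 2 r n)%:E)%E.
  have mA f : measurable [set w | `[(n%:R * e), +oo[%classic (incr_sum f n (X ^~ w))].
    rewrite -[X in measurable X]setTI.
    by apply: (measurable_incr_sum XP) => //; exact: measurable_itv.
  rewrite deviationE; apply: (le_trans (measureU2 Pr (mA d) (mA (fun u v => - d u v)))).
  have -> : geometric 2 r n = r ^+ n + r ^+ n by rewrite /geometric /=; ring.
  rewrite EFinD; apply: leeD; apply: prob_incr_sum_tail => //.
  - by move=> u; under eq_bigr do rewrite mulrN; rewrite sumrN pd oppr0.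
  - by move=> u v; rewrite normrN.
apply: (@le_lt_trans _ _ (2 / (1 - r))%:E); last exact: ltry.
apply: lime_le; first by apply: is_cvg_nneseries => n _ _; exact: measure_ge0.
apply: nearW => n; apply: (@le_trans _ _ (series (geometric 2 r) n)%:E).
  by rewrite /series /= -sumEFin; apply: lee_sum => i _; exact: Fr.
by rewrite lee_fin geometric_le_lim.
Qed.

(** Countably many thresholds 1/(j+1) suffice; [1 <= D] keeps them all within the range of the tail
    bound. *)
Lemma incr_sum_lln (d : T -> T -> R) (D : R) : stoch_kernel p ->
  (forall u, \sum_v p u v * d u v = 0) -> (forall u v, `|d u v| <= D) ->
  1 <= D ->
  {ae Pr, forall w, incr_sum d n (X ^~ w) / n%:R @[n --> \oo] --> (0 : R)}.
Proof.
move=> sp pd dD D1.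
apply: (@negligibleS _ _ _ Pr
    (\bigcup_j lim_sup_set (deviation d (j.+1%:R^-1)))); last first.
  apply: negligible_bigcup => j; apply: (@deviation_negligible _ D) => //.
  by apply: le_trans D1; rewrite invf_le1 // ler1n.
move=> w /=; apply: contra_notP => nF; apply/cvgrPdist_le => e e0.
have [j je] : exists j : nat, j.+1%:R^-1 <= e.
  exists (Num.truncn e^-1); rewrite -[leRHS]invrK lef_pV2 ?posrE ?invr_gt0 //.
  exact/ltW/Num.Theory.truncnS_gt.
have : ~ lim_sup_set (deviation d (j.+1%:R^-1)) w by move=> H; apply: nF; exists j.
move=> /existsNP [n /not_implyP [_ Hn]].
exists n.+1 => // m /= nm; have m0 : (0 < m)%N by exact: leq_ltn_trans nm.
rewrite sub0r normrN normrM normfV (ger0_norm (ler0n _ _)) ler_pdivrMr ?ltr0n //.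
rewrite leNgt; apply/negP => H; apply: Hn; exists m; first exact: ltnW.
rewrite /deviation /= mulrC; apply: le_trans (ltW H).
by rewrite ler_wpM2r.
Qed.

End MartingaleLLN.

(** * Poisson equation and asymptotic variance *)

Section PoissonDecomposition.
Context (R : realType) (n : nat) (P W : 'M[R]_n).
Hypotheses (sP : stochastic P) (eP : ergodic P).

Let pi := stationary_distr P.
Let dP := entrywise P W.
Let ddP := entrywise dP W.
Let Z' := fundamental_mx P - ones R n *m pi.

Definition mc_mean : R := (pi *m dP *m ones R n) 0 0.

Definition mc_variance : R :=
  (pi *m ddP *m ones R n) 0 0 - (pi *m dP *m ones R n) 0 0 ^+ 2
  + 2 * (pi *m dP *m Z' *m dP *m ones R n) 0 0.

Definition poisson_sol : 'cV[R]_n := Z' *m (dP *m ones R n).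

(** The profit of a step, centred and corrected by the increment of the Poisson solution so that it
    becomes a martingale difference. *)
Definition mart_incr (i j : 'I_n) : R :=
  W i j - mc_mean + poisson_sol j 0 - poisson_sol i 0.

Definition cond_variance : 'cV[R]_n := \col_i \sum_j P i j * mart_incr i j ^+ 2.

Let r i := \sum_j P i j * W i j.

Let rE i : (dP *m ones R n) i 0 = r i.
Proof. by rewrite mxE; apply: eq_bigr => j _; rewrite !mxE mulr1. Qed.

Let pi_sum1 : \sum_i pi 0 i = 1.
Proof. by have [[]] := stationary_distrP eP. Qed.

Let pi_inv (f : 'I_n -> R) :
  \sum_i pi 0 i * (\sum_j P i j * f j) = \sum_j pi 0 j * f j.
Proof.
have [_ piP] := stationary_distrP eP.
transitivity (\sum_j (pi *m P) 0 j * f j); last by rewrite piP.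
under eq_bigr do rewrite mulr_sumr.
rewrite exchange_big; apply: eq_bigr => j _ /=.
by rewrite mxE mulr_suml; apply: eq_bigr => i _; rewrite mulrA.
Qed.

Let poisson_equationE (f : 'cV[R]_n) i :
  (Z' *m f) i 0 - \sum_j P i j * (Z' *m f) j 0 = f i 0 - (pi *m f) 0 0.
Proof.
have subE (A B : 'cV[R]_n) : (A - B) i 0 = A i 0 - B i 0 by rewrite !mxE.
have := poisson_equation f sP eP => /(congr1 (fun A : 'cV[R]_n => A i 0)) /=.
rewrite !subE -/pi -/Z' => E.
rewrite (_ : \sum_j _ = (P *m (Z' *m f)) i 0); last by rewrite mxE.
by rewrite E [X in _ - X]mxE big_ord1 [ones _ _ _ _]mxE mul1r.
Qed.

Let poisson_solE i :
  \sum_j P i j * poisson_sol j 0 = poisson_sol i 0 - r i + mc_mean.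
Proof.
by have := poisson_equationE (dP *m ones R n) i; rewrite rE (mulmxA pi) -/poisson_sol -/mc_mean => H; lra.
Qed.

Lemma mart_incr_mean0 i : \sum_j P i j * mart_incr i j = 0.
Proof.
have E j : P i j * mart_incr i j = P i j * W i j + P i j * poisson_sol j 0 -
    P i j * (mc_mean + poisson_sol i 0) by rewrite /mart_incr; ring.
under eq_bigr do rewrite E.
by rewrite sumrB big_split /= -mulr_suml sP.2 poisson_solE -/(r i); ring.
Qed.

(** Expand the square and average under [pi]: the squares of the Poisson solution cancel by
    invariance, its mean is 0, and its cross term with [W] is the fundamental matrix term of the
    variance. *)
Lemma cond_variance_mean : (pi *m cond_variance) 0 0 = mc_variance.
Proof.
have pig : \sum_i pi 0 i * poisson_sol i 0 = 0.
  have : (pi *m poisson_sol) 0 0 = 0.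
    rewrite /poisson_sol mulmxA mulmxBr stationary_fundamental_mx //.
    rewrite (mulmxA pi) (mul_distr_ones (stationary_distrP eP).1).
    by rewrite mul1mx subrr mul0mx mxE.
  by rewrite mxE.
have vE i : cond_variance i 0 = (\sum_j P i j * W i j ^+ 2) - mc_mean ^+ 2 +
    (\sum_j P i j * poisson_sol j 0 ^+ 2) - poisson_sol i 0 ^+ 2 +
    2 * (\sum_j P i j * W i j * poisson_sol j 0) - 2 * mc_mean * poisson_sol i 0.
  rewrite mxE; pose m := mc_mean; pose g := poisson_sol.
  have E j : P i j * mart_incr i j ^+ 2 = P i j * W i j ^+ 2 +
      P i j * g j 0 ^+ 2 + 2 * (P i j * W i j * g j 0) +
      P i j * (m + g i 0) ^+ 2 -
      2 * (m + g i 0) * (P i j * W i j) - 2 * (m + g i 0) * (P i j * g j 0).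
    by rewrite /mart_incr -/m -/g; ring.
  under eq_bigr do rewrite E.
  rewrite !sumrB !big_split /= -!mulr_sumr -mulr_suml sP.2 poisson_solE -/(r i).
  by rewrite /m /g; ring.
rewrite mxE; under eq_bigr do rewrite vE.
have E i : pi 0 i * ((\sum_j P i j * W i j ^+ 2) - mc_mean ^+ 2 +
    (\sum_j P i j * poisson_sol j 0 ^+ 2) - poisson_sol i 0 ^+ 2 +
    2 * (\sum_j P i j * W i j * poisson_sol j 0) - 2 * mc_mean * poisson_sol i 0) =
  pi 0 i * (\sum_j P i j * W i j ^+ 2) - pi 0 i * mc_mean ^+ 2 +
  pi 0 i * (\sum_j P i j * poisson_sol j 0 ^+ 2) - pi 0 i * poisson_sol i 0 ^+ 2 +
  2 * (pi 0 i * (\sum_j P i j * W i j * poisson_sol j 0)) -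
  2 * mc_mean * (pi 0 i * poisson_sol i 0) by ring.
under eq_bigr do rewrite E.
rewrite !(sumrB, big_split) /= -!mulr_sumr pig -mulr_suml pi_sum1 pi_inv.
rewrite mulr0 subr0 addrK mul1r /mc_variance -/mc_mean.
congr (_ - _ + 2 * _).
  rewrite -mulmxA mxE; apply: eq_bigr => i _; congr (_ * _).
  by rewrite mxE; apply: eq_bigr => j _; rewrite !mxE mulr1 -mulrA -expr2.
rewrite -!mulmxA -/poisson_sol [RHS]mxE; apply: eq_bigr => i _; congr (_ * _).
by rewrite [RHS]mxE; apply: eq_bigr => j _; congr (_ * _); rewrite [RHS]mxE.
Qed.

Definition corrector : 'cV[R]_n := Z' *m cond_variance.

(** The Poisson equation again, with the conditional variance as right-hand side; this is the
    hypothesis on [h] in [clt_step]. *)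
Lemma correctorE i : corrector i 0 - \sum_j P i j * corrector j 0 =
  \sum_j P i j * mart_incr i j ^+ 2 - mc_variance.
Proof.
by rewrite /corrector poisson_equationE cond_variance_mean [X in X - _ = _]mxE.
Qed.

End PoissonDecomposition.

(** * Limit theorems for ergodic finite chains *)

Lemma finite_bound (R : realType) (T : finType) (f : T -> R) :
  exists D : R, 1 <= D /\ forall t, `|f t| <= D.
Proof.
exists (1 + \sum_t `|f t|); split=> [|t]; first by rewrite lerDl sumr_ge0.
rewrite (bigD1 t) //= addrCA lerDl addr_ge0 // sumr_ge0 //.
Qed.

Section ChainLimitTheorems.
Context (R : realType) (disp : measure_display) (Omega : measurableType disp)
  (Pr : probability Omega R) (T : finType) (X : nat -> Omega -> T)
  (P : 'M[R]_#|T|) (f : T -> T -> R).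
Hypotheses (XP : markov_chain Pr X P) (sP : stochastic P) (eP : ergodic P).

Let W := mx_of f.
Let p (u v : T) := P (enum_rank u) (enum_rank v).
Let mu := mc_mean P W.
Let s2 := mc_variance P W.
Let d (u v : T) := mart_incr P W (enum_rank u) (enum_rank v).
Let g (u : T) := poisson_sol P W (enum_rank u) 0.
Let h (u : T) := corrector P W (enum_rank u) 0.

Let sum_rank (F : 'I_#|T| -> R) : \sum_(v : T) F (enum_rank v) = \sum_j F j.
Proof. by rewrite [RHS](reindex _ (onW_bij _ (@enum_rank_bij T))). Qed.

Let sp : stoch_kernel p.
Proof. by split=> [u v|u]; [exact: sP.1|rewrite sum_rank; exact: sP.2]. Qed.

Let pd u : \sum_v p u v * d u v = 0.
Proof.
rewrite (sum_rank (fun j => P (enum_rank u) j * mart_incr P W (enum_rank u) j)).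
exact: mart_incr_mean0.
Qed.

Let ph u : h u - \sum_v p u v * h v = \sum_v p u v * d u v ^+ 2 - s2.
Proof.
rewrite (sum_rank (fun j => P (enum_rank u) j * corrector P W j 0)).
rewrite (sum_rank (fun j => P (enum_rank u) j * mart_incr P W (enum_rank u) j ^+ 2)).
exact: correctorE.
Qed.

Let incr_sumE n x :
  incr_sum f n x = incr_sum d n x + n%:R * mu - (g (x n) - g (x 0%N)).
Proof.
elim: n => [|n IH]; first by rewrite /incr_sum !big_ord0 mul0r subrr subr0 addr0.
rewrite /incr_sum !big_ord_recr /= -!/(incr_sum _ n x) IH.
have -> : d (x n) (x n.+1) = f (x n) (x n.+1) - mu + g (x n.+1) - g (x n).
  by rewrite /d /mart_incr mxE !enum_rankK.
by rewrite -natr1; ring.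
Qed.

Lemma markov_lln :
  {ae Pr, forall w, incr_sum f n (X ^~ w) / n%:R @[n --> \oo] --> mu}.
Proof.
have [D [D1 dD]] := finite_bound (fun uv : T * T => d uv.1 uv.2).
have [G [G1 gG]] := finite_bound g.
have := incr_sum_lln XP sp pd (fun u v => dD (u, v)) D1.
apply: filterS => w /cvgrPdist_le Mn; apply/cvgrPdist_le => e e0.
have e20 : 0 < e / 2 by rewrite divr_gt0.
have [n1 _ Hn1] := Mn _ e20.
(* Beyond 4 G / e the boundary term, at most 2 G / n, is below e / 2. *)
exists (maxn n1 (Num.truncn (4 * G / e)).+1) => // n /=; rewrite geq_max => /andP[n1n n2n].
have n0 : 0 < n%:R :> R by rewrite ltr0n; exact: leq_trans n2n.
have := Hn1 n n1n; rewrite /= sub0r normrN incr_sumE => H.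
have ne : 4 * G <= n%:R * e.
  rewrite -ler_pdivrMr // ltW //; apply: lt_le_trans (Num.Theory.truncnS_gt _) _.
  by rewrite ler_nat.
have -> : mu - (incr_sum d n (X ^~ w) + n%:R * mu - (g (X n w) - g (X 0%N w))) / n%:R =
  (g (X n w) - g (X 0%N w)) / n%:R - incr_sum d n (X ^~ w) / n%:R.
  by field; rewrite gt_eqF.
apply: le_trans (ler_normB _ _) _.
have : `|(g (X n w) - g (X 0%N w)) / n%:R| <= e / 2.
  rewrite normrM (gtr0_norm (x := _^-1)) ?invr_gt0 // ler_pdivrMr //.
  apply: le_trans (ler_normB _ _) _.
  by have := gG (X n w); have := gG (X 0%N w); lra.
lra.
Qed.

Let Y n w := (incr_sum f n (X ^~ w) - n%:R * mu) / Num.sqrt (n%:R * s2).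

(** The event [Y n w <= x] says that the martingale part is at most [x * q] plus a term bounded by
    [2 * G]. It is squeezed between two events with fixed thresholds, whose limits differ little
    because [gauss_cdf] is Lipschitz and [q] tends to infinity. *)
Lemma markov_clt : 0 < s2 -> cvg_in_distribution Pr Y (normal_prob 0 1).
Proof.
move=> s20.
have mY n : measurable_fun [set: Omega] (Y n).
  apply: measurable_realfun.measurable_funM => //; apply: measurable_realfun.measurable_funB => //.
  exact: (measurable_incr_sum XP).
split=> // x _.
have -> : (normal_prob (0 : R) 1 : probability (measurableTypeR R) R)
    `]-oo, x]%classic = (gauss_cdf x)%:E by exact: gauss_cdfE.
have mE n : measurable (Y n @^-1` `]-oo, x]%classic).
  by rewrite -[X in measurable X]setTI; apply: mY => //; exact: measurable_itv.
suff : fine (Pr (Y n @^-1` `]-oo, x]%classic)) @[n --> \oo] --> gauss_cdf x.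
  move=> H; apply/fine_cvgP; split=> //.
  by apply: nearW => n; apply: fin_num_measure.
apply/cvgrPdist_le => e e0.
have [D [D1 dD]] := finite_bound (fun uv : T * T => d uv.1 uv.2).
have [H [H1 hH]] := finite_bound h.
have [G [G1 gG]] := finite_bound g.
have e20 : 0 < e / 2 by rewrite divr_gt0.
have [N HN] := clt_uniform sp pd ph (fun u v => dD (u, v)) hH s20 e20.
have B0 := gauss_bound_ge0 R; set B := gauss_bound R in B0.
exists (maxn N (Num.truncn ((4 * B * G / e) ^+ 2 / s2)).+1) => // n /=.
rewrite geq_max => /andP[Nn n2n].
have n0 : 0 < n%:R :> R by rewrite ltr0n; exact: leq_trans n2n.
set q := Num.sqrt (n%:R * s2).
have q0 : 0 < q by rewrite sqrtr_gt0 mulr_gt0.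
have qB : B * (2 * G / q) <= e / 2.
  have : 4 * B * G / e <= q.
    have G0 : 0 <= G by lra.
    have k0 : 0 <= 4 * B * G / e.
      by apply: divr_ge0 (ltW e0); apply: mulr_ge0 => //; exact: mulr_ge0.
    rewrite -ler_sqr ?nnegrE ?(ltW q0) //.
    rewrite sqr_sqrtr; last by apply: mulr_ge0; exact: ltW.
    rewrite -ler_pdivrMr // ltW //.
    by apply: lt_le_trans (Num.Theory.truncnS_gt _) _; rewrite ler_nat.
  rewrite mulrA ler_pdivrMr // ler_pdivrMr // => ?; lra.
have sandwich (c : R) : `|fine (Pr [set w | `]-oo, (x * q + c)]%classic
     (incr_sum d n (X ^~ w))]) - gauss_cdf (x + c / q)| <= e / 2.
  apply: (prob_incr_sum_near XP); first exact: measurable_itv.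
  move=> v; have -> : (fun m (_ : T) => (m \in `]-oo, (x * q + c)]%classic)%:R) =
      (fun m (_ : T) => (m <= x * q + c)%R%:R) :> (R -> T -> R).
    by apply/funext => m; apply/funext => u; rewrite mem_setE in_itv.
  have -> : x + c / q = (x * q + c) / q by field; rewrite gt_eqF.
  exact: HN.
have mI c : measurable [set w | `]-oo, (x * q + c)]%classic (incr_sum d n (X ^~ w))].
  rewrite -[X in measurable X]setTI.
  by apply: (measurable_incr_sum XP) => //; exact: measurable_itv.
have YE w : (Y n w <= x) =
    (incr_sum d n (X ^~ w) <= x * q + (g (X n w) - g (X 0%N w))).
  rewrite /Y -/q ler_pdivrMr // incr_sumE.
  by apply/idP/idP => ?; lra.
have gd w : `|g (X n w) - g (X 0%N w)| <= 2 * G.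
  apply: le_trans (ler_normB _ _) _.
  by have := gG (X n w); have := gG (X 0%N w); lra.
have lo : fine (Pr [set w | `]-oo, (x * q - 2 * G)]%classic (incr_sum d n (X ^~ w))]) <=
    fine (Pr (Y n @^-1` `]-oo, x]%classic)).
  apply: fine_le; rewrite ?fin_num_measure //.
  apply: le_measure; rewrite ?inE // => w /=; rewrite !in_itv /= YE.
  by have := gd w; rewrite ler_norml => /andP[? ?]; lra.
have hi : fine (Pr (Y n @^-1` `]-oo, x]%classic)) <=
    fine (Pr [set w | `]-oo, (x * q + 2 * G)]%classic (incr_sum d n (X ^~ w))]).
  apply: fine_le; rewrite ?fin_num_measure //.
  apply: le_measure; rewrite ?inE // => w /=; rewrite !in_itv /= YE.
  by have := gd w; rewrite ler_norml => /andP[? ?]; lra.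
have L (c : R) : `|c| = 2 * G -> `|gauss_cdf (x + c / q) - gauss_cdf x| <= e / 2.
  move=> cG; apply: le_trans (gauss_cdf_lipschitz _ _) _; apply: le_trans qB.
  by rewrite normrM cG (gtr0_norm (x := _^-1)) ?invr_gt0.
have G2 : `|2 * G| = 2 * G by rewrite ger0_norm //; lra.
have := sandwich (2 * G); have := sandwich (- (2 * G)).
have := L _ G2; have := L (- (2 * G)); rewrite normrN G2 => /(_ erefl).
rewrite !ler_norml => /andP[a1 a2] /andP[b1 b2] /andP[c1 c2] /andP[d1 d2].
by apply/andP; split; lra.
Qed.

End ChainLimitTheorems.

(** * The games *)

Lemma minus1_in : -1 \in [:: -1; 0; 1 : int]. Proof. by []. Qed.
Lemma zero_in : 0 \in [:: -1; 0; 1 : int]. Proof. by []. Qed.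
Lemma one_in : 1 \in [:: -1; 0; 1 : int]. Proof. by []. Qed.

Definition loss : last_profit := SeqSub minus1_in.
Definition tie : last_profit := SeqSub zero_in.
Definition win : last_profit := SeqSub one_in.

Lemma sum_last_profit (R : realType) (F : last_profit -> R) :
  \sum_t F t = F loss + F tie + F win.
Proof.
rewrite (bigD1 loss) //= (bigD1 tie) //= (bigD1 win) //= big1 ?addr0 ?addrA //.
move=> [t tP] /=; rewrite -!(inj_eq val_inj) /= => H.
by exfalso; move: tP H; rewrite !inE; case: (t == -1); case: (t == 0); case: (t == 1).
Qed.

Lemma sum_state (R : realType) (N : nat) (F : state N -> R) :
  \sum_v F v = \sum_zeta (F (zeta, loss) + F (zeta, tie) + F (zeta, win)).
Proof.
transitivity (\sum_(v : config N * last_profit) F (v.1, v.2)).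
  by apply: eq_bigr => -[].
rewrite -(pair_bigA _ (fun a b => F (a, b))) /=.
by apply: eq_bigr => a _; rewrite sum_last_profit.
Qed.

Lemma flip_neq (N : nat) (eta : config N) x : flip eta x != eta.
Proof.
by apply/eqP => /ffunP /(_ x); rewrite ffunE eqxx; case: (eta x).
Qed.

(** After exchanging the sums each [x] contributes once, at [flip eta x], which is never [eta]. *)
Lemma sum_flip (R : realType) (N : nat) (eta : config N) (a : R)
    (Q : pred 'I_N) (c : 'I_N -> R) :
  \sum_zeta (if zeta == eta then a
    else \sum_(x < N | (zeta == flip eta x) && Q x) c x) =
  a + \sum_(x < N | Q x) c x.
Proof.
rewrite (bigD1 eta) //= eqxx; congr (_ + _).
rewrite (eq_bigr (fun zeta => \sum_(x < N | Q x) (if zeta == flip eta x then c x else 0))); last first.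
  move=> zeta /negPf ->; rewrite big_mkcondl /=.
  by rewrite [LHS]big_mkcond [RHS]big_mkcond; apply: eq_bigr => x _; case: (Q x).
rewrite exchange_big; apply: eq_bigr => x Qx /=.
rewrite (bigD1 (flip eta x)) ?flip_neq //= eqxx big1 ?addr0 //.
by move=> zeta /andP[_ /negPf ->].
Qed.

Lemma PB_entry_ge0 (R : realType) (N : nat) (p : 'I_4 -> R) (u v : state N) :
  (forall m, 0 <= p m <= 1) -> 0 <= PB_entry p u v.
Proof.
move=> hp; have p0 m : 0 <= p m by have /andP[] := hp m.
have q0 m : 0 <= 1 - p m by rewrite subr_ge0; have /andP[] := hp m.
case: u v => eta s [zeta t] /=; have N0 : 0 <= N%:R^-1 :> R by rewrite invr_ge0.
by do ?case: ifP => _ //; rewrite ?mulr_ge0 // sumr_ge0 // => x _; rewrite ?mulr_ge0.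
Qed.

Lemma PB_entry_sum (R : realType) (N : nat) (p : 'I_4 -> R) (u : state N) :
  (0 < N)%N -> \sum_v PB_entry p u v = 1.
Proof.
case: u => eta s N0; rewrite sum_state /= !big_split /= big1_eq addr0 !sum_flip.
rewrite -!mulr_sumr -!mulrDr -[RHS](mulVf (_ : N%:R != 0 :> R)) ?pnatr_eq0 -?lt0n //.
congr (_ * _); have -> : N%:R = \sum_(x < N) 1 :> R by rewrite sumr_const card_ord.
rewrite ?sumrB ?sumrN [RHS](bigID (fun x => eta x)) /=; ring.
Qed.

(** Ensures that each player has two distinct neighbours, so that game A' has exactly 4N choices. *)
Lemma ord_pred_neq_ordS (N : nat) (x : 'I_N) : (3 <= N)%N -> ord_pred x != ordS x.
Proof.
move=> N3; rewrite -(inj_eq val_inj) /=; case: x => x xN /=.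
have [xE|xN1] := eqVneq x.+1 N.
  rewrite xE modnn; case: x xN xE => [|x] xN xE; first by lia.
  by rewrite addSn /= modnDr modn_small; lia.
have xN2 : (x.+1 < N)%N by rewrite ltn_neqAle xN1.
rewrite (modn_small xN2); case: x xN xN1 xN2 => [|x] xN xN1 xN2.
  by rewrite add0n modn_small; lia.
by rewrite addSn /= modnDr modn_small; lia.
Qed.

Lemma PA_entry_sum (R : realType) (N : nat) (u : state N) :
  (3 <= N)%N -> \sum_v PA_entry R u v = 1.
Proof.
case: u => eta s N3; rewrite sum_state /=.
under eq_bigr do rewrite add0r addr0.
rewrite -mulr_sumr -natr_sum.
have -> : (\sum_(zeta : config N) #|[set a : 'I_N * 'I_N * bool |
   let: (x, y, eps) := a in ((y == ord_pred x) || (y == ordS x)) &&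
        (transfer eta x y eps == zeta)]%SET| = 4 * N)%N.
  under eq_bigr do rewrite -sum1_card big_mkcond /=.
  rewrite exchange_big /=.
  rewrite (eq_bigr (fun a => ((a.1.2 == ord_pred a.1.1) || (a.1.2 == ordS a.1.1) : nat))); last first.
    move=> [[x y] eps] _ /=; rewrite (bigD1 (transfer eta x y eps)) //= inE eqxx andbT.
    rewrite big1 ?addn0; first by case: (_ || _).
    by move=> zeta /negPf nz; rewrite inE (eq_sym (transfer _ _ _ _)) nz andbF.
  rewrite -(pair_bigA _ (fun a (b : bool) => ((a.2 == ord_pred a.1) || (a.2 == ordS a.1) : nat))) /=.
  rewrite -(pair_bigA _ (fun x y => \sum_(b : bool) ((y == ord_pred x) || (y == ordS x) : nat))) /=.
  rewrite -[RHS]mulnC -[X in (X * _)%N](card_ord N) -sum_nat_const; apply: eq_bigr => x _.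
  rewrite (bigD1 (ord_pred x)) //= (bigD1 (ordS x)) ?(eq_sym (ordS x)) ?ord_pred_neq_ordS //=.
  rewrite !big_bool !eqxx /= orbT big1 // => y /andP[/negPf -> /negPf ->].
  by rewrite big_bool.
by rewrite mulVf // pnatr_eq0 muln_eq0 /=; case: N N3 {eta}.
Qed.

Lemma PA_entry_ge0 (R : realType) (N : nat) (u v : state N) : 0 <= PA_entry R u v.
Proof.
by case: u v => eta s [zeta t] /=; case: ifP => // _; rewrite mulr_ge0 ?invr_ge0.
Qed.

Lemma PC_entry (R : realType) (N : nat) (gamma : R) (p : 'I_4 -> R) u v :
  PC N gamma p (enum_rank u) (enum_rank v) =
  gamma * PA_entry R u v + (1 - gamma) * PB_entry p u v.
Proof. by rewrite !mxE !enum_rankK. Qed.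

Lemma PC_stochastic (R : realType) (N : nat) (gamma : R) (p : 'I_4 -> R) :
  (3 <= N)%N -> 0 < gamma < 1 -> (forall m, 0 <= p m <= 1) ->
  stochastic (PC N gamma p).
Proof.
move=> N3 /andP[g0 g1] hp; have g1' : 0 <= 1 - gamma by rewrite subr_ge0 ltW.
split=> [i j|i].
  by rewrite !mxE addr_ge0 ?mulr_ge0 ?PA_entry_ge0 ?PB_entry_ge0 ?(ltW g0).
rewrite -(enum_valK i) (reindex _ (onW_bij _ (@enum_rank_bij (state N)))) /=.
under eq_bigr do rewrite PC_entry.
rewrite big_split /= -!mulr_sumr PA_entry_sum // PB_entry_sum; first by ring.
exact: leq_trans N3.
Qed.

(** * Ergodicity of the mixed game *)

Definition outcome (b : bool) : last_profit := if b then win else loss.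

(** The probability that player [x], once chosen in game B, ends with status [b]. *)
Definition flip_weight (R : realType) (N : nat) (p : 'I_4 -> R) (b : bool)
    (eta : config N) (x : 'I_N) : R :=
  if b then p (nbr_index eta x) else 1 - p (nbr_index eta x).

Lemma PB_entry_flip (R : realType) (N : nat) (p : 'I_4 -> R) (b : bool)
    (eta : config N) (s : last_profit) (x : 'I_N) : (0 < N)%N ->
  (forall m, 0 <= p m <= 1) -> eta x = ~~ b ->
  0 < flip_weight p b eta x -> 0 < PB_entry p (eta, s) (flip eta x, outcome b).
Proof.
move=> N0 hp; have p0 m : 0 <= p m by have /andP[] := hp m.
have q0 m : 0 <= 1 - p m by rewrite subr_ge0; have /andP[] := hp m.
have Ni : 0 < N%:R^-1 :> R by rewrite invr_gt0 ltr0n.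
case: b => /= ex w; rewrite /= (negPf (flip_neq eta x)).
all: rewrite (bigD1 x) ?eqxx ?ex //= ltr_pwDl ?mulr_gt0 //.
all: by apply: sumr_ge0 => y _; rewrite mulr_ge0 // ltW.
Qed.

Lemma PB_entry_const (R : realType) (N : nat) (p : 'I_4 -> R) (b : bool)
    (eta : config N) (s : last_profit) (x0 : 'I_N) :
  (forall x, eta x = b) -> (forall x, 0 < flip_weight p b eta x) ->
  0 < PB_entry p (eta, s) (eta, outcome b).
Proof.
move=> eb w; have Ni : 0 < N%:R^-1 :> R.
  by rewrite invr_gt0 ltr0n; exact: leq_ltn_trans (ltn_ord x0).
case: b eb w => eb w /=; rewrite eqxx mulr_gt0 // (bigD1 x0) ?eb //= ltr_pwDl ?w //.
all: by apply: sumr_ge0 => y _; apply/ltW/w.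
Qed.

(** Otherwise the status [~~ b] would propagate around the circle from [x1] to [x0]. *)
Lemma cyclic_boundary (N : nat) (eta : config N) (b : bool) (x0 x1 : 'I_N) :
  eta x0 = b -> eta x1 = ~~ b -> exists x, eta x = ~~ b /\ eta (ordS x) = b.
Proof.
move=> e0 e1; apply: contrapT => nex.
have H x : eta x = ~~ b -> eta (ordS x) = ~~ b.
  move=> ex; apply: contrapT => ne; apply: nex; exists x; split=> //.
  by move: ne; case: (eta _) (b) => [] [].
have Hk k : eta (iter k (@ordS N) x1) = ~~ b by elim: k => //= k; exact: H.
have vk k : val (iter k (@ordS N) x1) = ((x1 + k) %% N)%N.
  elim: k => [|k IH]; first by rewrite addn0 modn_small.
  by rewrite iterS /= IH -addn1 modnDml addn1 addnS.
(* This count is congruent to [x0 - x1] mod [N] and avoids truncated subtraction. *)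
have := Hk (x0 + (N - x1))%N.
have -> : iter (x0 + (N - x1)) (@ordS N) x1 = x0.
  apply: val_inj; rewrite vk addnCA subnKC ?modnDr ?modn_small //; exact: ltnW.
by rewrite e0; case: (b).
Qed.

Lemma PC_gt0_B (R : realType) (N : nat) (gamma : R) (p : 'I_4 -> R) u v :
  0 < gamma < 1 -> 0 < PB_entry p u v ->
  0 < PC N gamma p (enum_rank u) (enum_rank v).
Proof.
move=> /andP[g0 g1] H; rewrite PC_entry ltr_wpDl //.
  by rewrite mulr_ge0 ?PA_entry_ge0 // ltW.
by rewrite mulr_gt0 // subr_gt0.
Qed.

Lemma PC_ergodic_to (R : realType) (N : nat) (gamma : R) (p : 'I_4 -> R)
    (b : bool) :
  (3 <= N)%N -> 0 < gamma < 1 -> (forall m, 0 <= p m <= 1) ->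
  (forall (eta : config N) x, eta (ordS x) = b -> 0 < flip_weight p b eta x) ->
  ergodic (PC N gamma p).
Proof.
move=> N3 g01 hp hb; have sP := PC_stochastic N3 g01 hp.
have N0 : (0 < N)%N by exact: leq_trans N3.
pose x0 : 'I_N := Ordinal N0.
pose target : config N := [ffun=> b].
pose o : state N := (target, outcome b).
have toT s : 0 < PC N gamma p (enum_rank (target, s)) (enum_rank o).
  apply: PC_gt0_B => //; apply: PB_entry_const x0 _ _ => x; first by rewrite ffunE.
  by apply: hb; rewrite ffunE.
(* Induction on the number of players with the wrong status: one of them has a right neighbour with
   status [b] and can be flipped by game B. *)
have mixed n (eta : config N) (s : last_profit) : #|[set x | eta x != b]%SET| = n -> (exists x, eta x = b) ->
    exists k, 0 < (PC N gamma p ^+ k) (enum_rank (eta, s)) (enum_rank o).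
  elim: n eta s => [|n IH] eta s.
    move=> /cards0_eq e0 _; exists 1%N; rewrite expr1.
    suff -> : eta = target by exact: toT.
    apply/ffunP => x; rewrite ffunE; apply/eqP.
    by have := finset.in_set0 x; rewrite -e0 inE => /negbFE.
  move=> en [y ey].
  have [x1] : exists x, x \in [set x | eta x != b]%SET.
    by apply/set0Pn; rewrite -card_gt0 en.
  rewrite inE => x1b; have {}x1b : eta x1 = ~~ b by move: x1b; case: (eta x1) (b) => [] [].
  have [x [ex exS]] := cyclic_boundary ey x1b.
  have fx : flip eta x x = b by rewrite ffunE eqxx ex negbK.
  have fn : #|[set z | flip eta x z != b]%SET| = n.
    apply/eqP; rewrite -(eqn_add2l 1) (add1n n) -en (cardsD1 x [set z | eta z != b]%SET).
    rewrite inE ex; apply/eqP; have -> : ~~ b != b by case: (b).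
    congr (_ + #|pred_of_set _|)%N; apply/setP => z; rewrite !inE.
    by have [->|zx] := eqVneq z x; rewrite ?fx ?eqxx // ffunE (negPf zx).
  have [k Hk] := IH _ (outcome b) fn (ex_intro _ x fx).
  exists (1 + k)%N; apply: exp_mx_gt0_trans Hk => //; rewrite expr1.
  by apply: PC_gt0_B => //; apply: PB_entry_flip => //; exact: hb.
apply: (@reachable_ergodic _ _ _ (enum_rank o)) => [//||i]; first exact: toT.
rewrite -(enum_valK i); case: (enum_val i) => eta s.
have [eb|neb] := pselect (exists x, eta x = b); first exact: mixed erefl eb.
have eNb x : eta x = ~~ b.
  have : eta x != b by apply/eqP => H; apply: neb; exists x.
  by case: (eta x) (b) => [] [].
(* From the opposite constant state, a transfer in game A' gives [ordS x0] the status [b]. *)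
pose eta' := transfer eta x0 (ordS x0) (~~ b).
have e'b : eta' (ordS x0) = b.
  rewrite ffunE eqxx negbK ifN // -(inj_eq val_inj) /=.
  by rewrite modn_small //; exact: leq_trans N3.
have [k Hk] := mixed _ eta' tie erefl (ex_intro _ _ e'b).
exists (1 + k)%N; apply: exp_mx_gt0_trans Hk => //; rewrite expr1 PC_entry.
have /andP[g0 g1] := g01.
rewrite ltr_pwDl //; last by rewrite mulr_ge0 ?PB_entry_ge0 // subr_ge0 ltW.
rewrite mulr_gt0 //= mulr_gt0 ?invr_gt0 ?ltr0n ?muln_gt0 //.
apply/card_gt0P; exists (x0, ordS x0, ~~ b).
by rewrite inE eqxx orbT eqxx.
Qed.

(** A right neighbour of status 0 leaves only the indices 0 and 2, one of status 1 only 1 and 3;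
    each alternative of the hypothesis covers one of these pairs. *)
Lemma PC_ergodic (R : realType) (N : nat) (gamma : R) (p : 'I_4 -> R) :
  (3 <= N)%N -> 0 < gamma < 1 -> (forall m, 0 <= p m <= 1) ->
  (forall m : 'I_4, (m <= 2)%N -> 0 < p m < 1) \/
  (forall m : 'I_4, (1 <= m)%N -> 0 < p m < 1) ->
  ergodic (PC N gamma p).
Proof.
move=> N3 g01 hp [hl|hr].
- apply: (@PC_ergodic_to _ _ _ _ false) => // eta x ex.
  rewrite /flip_weight subr_gt0; apply: (proj2 (andP (hl _ _))).
  by rewrite /nbr_index ex inordK; case: (eta _).
- apply: (@PC_ergodic_to _ _ _ _ true) => // eta x ex.
  rewrite /flip_weight; apply: (proj1 (andP (hr _ _))).
  by rewrite /nbr_index ex inordK; case: (eta _).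
Qed.

Lemma total_profitE (R : realType) (N : nat) (Omega : Type)
    (X : nat -> Omega -> state N) n w :
  total_profit R X n w = incr_sum (@payoff R N) n (X ^~ w).
Proof. by rewrite /total_profit /incr_sum big_add1 big_mkord. Qed.

Theorem theorem7 (R : realType) (N : nat) (gamma : R) (p : 'I_4 -> R)
    (hN : (3 <= N)%N)
    (hgamma : 0 < gamma < 1)
    (hp : forall m : 'I_4, 0 <= p m <= 1)
    (hp' : (forall m : 'I_4, (m <= 2)%N -> 0 < p m < 1) \/
           (forall m : 'I_4, (1 <= m)%N -> 0 < p m < 1)) :
  ergodic (PC N gamma p) /\
  forall (d : measure_display) (Omega : measurableType d)
    (Pr : probability Omega R) (X : nat -> Omega -> state N),
    markov_chain Pr X (PC N gamma p) ->
    let mu := mean_profit N gamma p in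
    let sigma2 := var_profit N gamma p in
    let S := total_profit R X in
    {ae Pr, forall w, S n w / n%:R @[n --> \oo] --> mu} /\
    (0 < sigma2 ->
     cvg_in_distribution Pr
       (fun n w => (S n w - n%:R * mu) / Num.sqrt (n%:R * sigma2))
       (normal_prob 0 1)).
Proof.
have sP := PC_stochastic hN hgamma hp.
have eP := PC_ergodic hN hgamma hp hp'.
split=> // d Omega Pr X XP mu sigma2 S.
have SE : S = fun n w => incr_sum (@payoff R N) n (X ^~ w).
  by apply/funext => n; apply/funext => w; exact: total_profitE.
(* [mean_profit] and [var_profit] unfold to [mc_mean] and [mc_variance] for the payoff matrix. *)
rewrite SE; split; first exact: (markov_lln (@payoff R N) XP sP eP).
exact: (markov_clt XP sP eP).
Qed.
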